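(* Let $m \geq 6$ be an integer and let $r \geq 2$ be the number of distinct prime divisors of $m$. (i) For every family $(C_n)_{n \in \mathbb{N}}$ such that each $C_n$ is a $\mathbf{Sym}_n$-symmetric $\mathrm{MOD}_m$-circuit on the variables $x_1,\dots,x_n$ computing $\mathrm{AND}_n$, the size satisfies $|C_n| \geq 2^{\Omega(n^{1/r}\cdot \log n)}$. (ii) There exists a family $(D_n)_{n\in\mathbb{N}}$ of $\mathrm{MOD}_m$-circuits of depth $2$, where $D_n$ computes $\mathrm{AND}_n$, with $|D_n| \le 2^{O(n^{1/r}\cdot \log n)}$.
   Context: For $R \subseteq \mathbb{Z}_m$, the gate $\mathrm{MOD}_m^R$ has arbitrary fan-in and on Boolean inputs $y_1,\dots,y_k$ outputs $1$ iff $(\sum_i y_i \bmod m) \in R$. A $\mathrm{MOD}_m$-circuit on variables $x_1,\dots,x_n$ is a finite directed acyclic graph (multiple wires between two gates allowed) with a single designated output gate; the gates without incoming wires are input gates, each labelled by a variable, with exactly one input gate per variable; every other gate is labelled $\mathrm{MOD}_m^R$ for some $R \subseteq \mathbb{Z}_m$ (which may differ between gates) and computes that operation on the values of its children, each child counted with the multiplicity of its wire. The circuit computes the function at its output gate. Its size $|C|$ is the number of gates plus the number of wires counted with multiplicity; its depth is the maximum number of wires on a path from the output gate to an input gate. $\mathrm{AND}_n$ is the $n$-ary Boolean conjunction. For $\Gamma \le \mathbf{Sym}_n$, a circuit $C$ on $x_1,\dots,x_n$ is $\Gamma$-symmetric if for every $\pi\in\Gamma$ there is a bijection $\sigma$ of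 the gates of $C$ that is a circuit automorphism (preserves the operation labels of internal gates and the multiplicity of every wire) and maps the input gate labelled $x_i$ to the input gate labelled $x_{\pi(i)}$ for every $i$. *)

(* Defs.v *)
From HB Require Import structures.
From mathcomp Require Import all_boot all_order all_algebra all_fingroup.
From mathcomp Require Import reals exp.

Set Implicit Arguments.
Unset Strict Implicit.
Unset Printing Implicit Defensive.

Import GRing.Theory.

(* Residue sets are sets over 'Z_m, which is the ring of integers mod m only  *)
(* when 1 < m.                                                                *)
(* [wires g h] is the number of wires entering [g] from its child [h], so     *)
(* the relation [0 < wires g h] points from a gate to its children.           *)
Record circuit (m n : nat) := Circuit {
  gate : finType;
  label : gate -> 'I_n + {set 'Z_m};
  wires : gate -> gate -> nat;
  output : gate;
  input_uniq : forall i : 'I_n, exists! g, label g = inl i;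
  inputP : forall g, (exists i, label g = inl i) <-> (forall h, wires g h = 0);
  acyclic : forall s : seq gate,
    s != [::] -> ~~ path.cycle (fun g h => 0 < wires g h) s }.

Section Circuit.

Variables m n : nat.
Implicit Type C : circuit m n.

Definition wire C : rel (gate C) := fun g h => 0 < wires g h.

Definition MOD (R : {set 'Z_m}) (s : nat) : bool := (s%:R)%R \in R.

(* The fuel k is harmless: by [gate_valE] below, #|gate C| steps always reach *)
(* the inputs.                                                                *)
Fixpoint gate_val_rec C (x : {ffun 'I_n -> bool}) (k : nat) (g : gate C) : bool :=
  if k is k'.+1 then
    match label g with
    | inl i => x i
    | inr R => MOD R (\sum_(h : gate C) wires g h * gate_val_rec x k' h)
    end
  else false.

Definition gate_val C (x : {ffun 'I_n -> bool}) (g : gate C) : bool :=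
  gate_val_rec x #|gate C| g.

Definition computes C (f : {ffun 'I_n -> bool} -> bool) : Prop :=
  forall x, gate_val x (output C) = f x.

Definition circuit_size C : nat :=
  #|gate C| + \sum_(g : gate C) \sum_(h : gate C) wires g h.

Definition is_input C (g : gate C) : bool :=
  if label g is inl _ then true else false.

(* Restricting to path lengths k < #|gate C| loses nothing, by [wire_path_size]. *)
Definition depth C : nat :=
  \max_(k < #|gate C| |
      [exists p : k.-tuple (gate C),
         path (@wire C) (output C) p && is_input (last (output C) p)]) k.

Definition automorphism C (s : {perm gate C}) : Prop :=
  (forall g R, label g = inr R -> label (s g) = inr R) /\
  (forall g h, wires (s g) (s h) = wires g h).

Definition symmetric_circuit (G : {group 'S_n}) C : Prop :=
  forall pi : 'S_n, pi \in G ->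
    exists2 s : {perm gate C}, automorphism s &
      forall g i, label g = inl i -> label (s g) = inl (pi i).

Lemma wire_path_uniq C (g : gate C) p : path (@wire C) g p -> uniq (g :: p).
Proof.
elim: p g => [//|h p IHp] g gp; have /andP[_ hp] := gp.
rewrite cons_uniq IHp // andbT; apply/negP => g_in.
case/path.splitP: g_in gp => p1 p2; rewrite cat_path => /andP[gp1 _].
by have /negP[] := @acyclic _ _ C (g :: p1) isT.
Qed.

Lemma wire_path_size C (g : gate C) p :
  path (@wire C) g p -> size p < #|gate C|.
Proof.
by move=> /wire_path_uniq/card_uniqP/= cardE; rewrite -[_ < _]/((size p).+1 <= _) -cardE max_card.
Qed.

Lemma gate_val_recS C x k (g : gate C) :
    (forall p, path (@wire C) g p -> size p < k) ->
  gate_val_rec x k.+1 g = gate_val_rec x k g.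
Proof.
elim: k g => [|k IHk] g gk; first by have := gk [::] isT.
rewrite /=; case: (label g) => // R; congr MOD; apply: eq_bigr => h _.
have [->//|w_gt0] := posnP (wires g h).
by congr (_ * _); rewrite -IHk // => p hp; apply: (gk (h :: p)); rewrite /= hp andbT.
Qed.

Lemma gate_valE C x (g : gate C) :
  gate_val x g =
    match label g with
    | inl i => x i
    | inr R => MOD R (\sum_(h : gate C) wires g h * gate_val x h)
    end.
Proof. by rewrite {1}/gate_val -gate_val_recS // => p; apply: wire_path_size. Qed.

End Circuit.

Definition AND (n : nat) (x : {ffun 'I_n -> bool}) : bool := [forall i, x i].

(* Main.v *)
Require Import Defs.
From HB Require Import structures.
From mathcomp Require Import all_boot all_order all_algebra all_fingroup.
From mathcomp Require Import boolp reals exp.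
From mathcomp Require Import zify lra.

(* Lower bound.  The automorphisms of C fixing a gate g project to a subgroup *)
(* of 'S_n of index at most |C|.  A subgroup G of Sym W whose index is below  *)
(* 'C(|W|/3, j+1) contains all 3-cycles on an invariant set X missing at most *)
(* j points of W (a 3-cycle is obtained as the commutator of two elements     *)
(* whose supports share one point).  Choose M <= n/2 to be a product of prime *)
(* powers, one of size about n^(1/r) for each prime divisor of m, so that m   *)
(* divides 'C(M, t) for all 0 < t <= j, where j is of order n^(1/r).  Let D   *)
(* be a set of M inputs such that the output gate is fixed by the 3-cycles on *)
(* D.  Going down from such a gate, each child is either again fixed by the   *)
(* 3-cycles on D, or lies in an orbit whose size is a multiple of 'C(M, t)    *)
(* for some 0 < t <= j, hence of m.  So the circuit cannot tell the input     *)
(* with ones on D from the one with zeros on D, unless |C|^2 >=               *)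
(* 'C(M/3, j+1) = 2^Omega(n^(1/r) log n).                                     *)
(*                                                                            *)
(* Upper bound.  With w the number of zeros of the input and Q = q^k,         *)
(* sum_(j < Q) (-1)^j 'C(w, j) = [Q | w] mod q.  The terms are sums over      *)
(* small sets S of [x = 0 on S], which for a prime p <> q is, mod q, a        *)
(* combination of the p^|S| gates [a.x = 1 mod p].  One top gate checks all   *)
(* the conditions Q_q | w, for Q_q > n^(1/r), by the Chinese remainder        *)
(* theorem.                                                                   *)

Set Implicit Arguments.
Unset Strict Implicit.
Unset Printing Implicit Defensive.

Import Order.TTheory GRing.Theory Num.Theory.

(** * Subgroups of small index in a symmetric group *)

(** Both bounds come from binomial coefficients modulo primes, and the exponent n^(1/r) appears
    because r prime powers of order n^(1/r), one per prime of m, have a product of order n.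

    Lower bound. [small_index_support] is the group theory: a subgroup of small index contains all
    3-cycles on almost all points. [orbit_local_aut] applies it to the children of a gate that
    respects the 3-cycles on D: a child respects them too, or its orbit has size divisible by m, so
    that a MOD gate ignores that orbit on inputs constant on D. [gate_val_block] is the induction
    along the circuit, [dvdn_bin_block] the arithmetic, and [symmetric_AND_size] the resulting
    estimate.

    Upper bound. AND holds iff the number w of zeros is 0. As w <= n, it suffices that w be
    divisible by the chosen prime powers once their product exceeds n. [gadgetE] tests one prime
    power, [chinese_sum] merges the tests into one top gate, and [depth2_AND] assembles the
    circuit. *)

Lemma leq_bin_unimodal n a t : a <= t -> a + t <= n -> 'C(n, a) <= 'C(n, t).
Proof.
elim: n a t => [|n IHn] [|a] t; rewrite ?bin0 ?bin_gt0 //.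
case: t => [|t] at_ atn //.
have [->//|neq] := eqVneq a t.
have [eqn|ltn] := eqVneq (a.+1 + t.+1) n.+1.
  have /bin_sub : t.+1 <= n.+1 by lia.
  have -> : n.+1 - t.+1 = a.+1 by lia.
  by move=> ->.
by rewrite !binS leq_add ?IHn //; lia.
Qed.

Section ThreeCycles.

Local Open Scope group_scope.

Variable T : finType.
Implicit Types (x y z : T) (U W X Y : {set T}) (G L H : {group {perm T}}).

Definition cycle3 x y z : {perm T} := tperm x y * tperm x z.

Definition all_cycle3 X (G : {set {perm T}}) := [forall x in X, forall y in X, forall z in X,
  uniq [:: x; y; z] ==> (cycle3 x y z \in G)].

Lemma all_cycle3P X (G : {set {perm T}}) :
  reflect (forall x y z, x \in X -> y \in X -> z \in X -> uniq [:: x; y; z] ->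
             cycle3 x y z \in G)
          (all_cycle3 X G).
Proof.
apply: (iffP idP) => [|h].
  move=> /forall_inP h x y z xX yX zX u.
  by have /forall_inP/(_ y yX)/forall_inP/(_ z zX)/implyP/(_ u) := h x xX.
apply/forall_inP => x xX; apply/forall_inP => y yX; apply/forall_inP => z zX.
by apply/implyP; apply: h.
Qed.

Lemma cycle3J x y z (s : {perm T}) : cycle3 x y z ^ s = cycle3 (s x) (s y) (s z).
Proof. by rewrite conjMg !tpermJ. Qed.

Lemma cycle3V x y z : (cycle3 x y z)^-1 = cycle3 x z y.
Proof. by rewrite /cycle3 invMg !tpermV. Qed.

Lemma cycle3_1 x y z : uniq [:: x; y; z] -> cycle3 x y z x = y.
Proof.
rewrite /= !inE !negb_or => /andP[/andP[xy xz] /andP[yz _]].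
by rewrite /cycle3 permM tpermL tpermD // eq_sym.
Qed.

Lemma cycle3_2 x y z : cycle3 x y z y = z.
Proof. by rewrite /cycle3 permM tpermR tpermL. Qed.

Lemma cycle3_3 x y z : uniq [:: x; y; z] -> cycle3 x y z z = x.
Proof.
rewrite /= !inE !negb_or => /andP[/andP[xy xz] /andP[yz _]].
by rewrite /cycle3 permM (tpermD xz yz) tpermR.
Qed.

Lemma cycle3D x y z t : t \notin [:: x; y; z] -> cycle3 x y z t = t.
Proof.
rewrite !inE !negb_or => /and3P[tx ty tz].
by rewrite /cycle3 permM !tpermD // eq_sym.
Qed.

Lemma cycle3_rot x y z : uniq [:: x; y; z] -> cycle3 y z x = cycle3 x y z.
Proof.
move=> u; have u' : uniq [:: y; z; x] by rewrite (rot_uniq 1 [:: x; y; z]).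
apply/permP => t; have [|tn] := boolP (t \in [:: x; y; z]); last first.
  by rewrite !cycle3D // (mem_rot 1 [:: x; y; z]).
rewrite !inE => /or3P[]/eqP->.
- by rewrite cycle3_1 // cycle3_3.
- by rewrite cycle3_1 // cycle3_2.
- by rewrite cycle3_2 cycle3_3.
Qed.

Lemma cycle3_on X x y z : x \in X -> y \in X -> z \in X -> cycle3 x y z \in Sym X.
Proof.
move=> xX yX zX; rewrite inE; apply/subsetP => t; rewrite inE; apply: contraR => tX.
by rewrite cycle3D // !inE !negb_or; apply/and3P; split; apply: contraNneq tX => ->.
Qed.

Lemma mem_cycle3V G x y z : (cycle3 x z y \in G) = (cycle3 x y z \in G).
Proof. by rewrite -cycle3V groupV. Qed.

Lemma uniq3 x y z : uniq [:: x; y; z] = [&& x != y, x != z & y != z].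
Proof. by rewrite /= !inE !negb_or andbT -andbA. Qed.

Lemma mem_cycle3_swap G x y z : uniq [:: x; y; z] ->
  (cycle3 y x z \in G) = (cycle3 x y z \in G).
Proof. by move=> u; rewrite -mem_cycle3V cycle3_rot. Qed.

(** Conjugating [cycle3 a b z] by [cycle3 a b d] gives [cycle3 b d z]. Such steps lead from the pair
    (p, q) to every ordered pair of distinct points of X. *)
Lemma all_cycle3_ext G X p q z : all_cycle3 X G -> p \in X -> q \in X -> z \notin X ->
  p != q -> cycle3 p q z \in G -> all_cycle3 (z |: X) G.
Proof.
move=> /all_cycle3P fX pX qX zX pq pqz.
have nz x : x \in X -> x != z by move=> xX; apply: contraNneq zX => <-.
have step a b d : a \in X -> b \in X -> d \in X -> a != b -> d != b ->
    cycle3 a b z \in G -> cycle3 b d z \in G.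
  move=> aX bX dX ab db abz; have [->|da] := eqVneq d a.
    by rewrite mem_cycle3_swap // uniq3 ab !nz.
  have u : uniq [:: a; b; d] by rewrite uniq3 ab eq_sym da eq_sym db.
  have := fX a b d aX bX dX u => abd.
  have := groupJ abz abd; rewrite cycle3J cycle3_1 // cycle3_2 cycle3D //.
  by rewrite !inE !negb_or ![z == _]eq_sym !nz.
have key x y : x \in X -> y \in X -> x != y -> cycle3 x y z \in G.
  move=> xX yX xy.
  have [xq|xq] := eqVneq x q; first by subst x; apply: (step p) => //; rewrite eq_sym.
  by apply: (step q) => //; rewrite 1?eq_sym //; apply: (step p).
apply/all_cycle3P => a b c; rewrite !in_setU1.
case/predU1P=> [->|aX]; case/predU1P=> [->|bX]; case/predU1P=> [->|cX];
  rewrite ?uniq3 ?eqxx ?andbF //= => /and3P[ab ac bc].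
- by rewrite -cycle3_rot ?uniq3 ?ab ?ac ?bc //; apply: key.
- rewrite -cycle3_rot; last by rewrite uniq3 ab ac.
  rewrite -cycle3_rot ?uniq3; last by rewrite bc eq_sym ab eq_sym ac.
  by apply: key; rewrite // eq_sym.
- exact: key.
- by apply: fX; rewrite // uniq3 ab ac.
Qed.

(* If the supports of u and v meet only in p, then [u, v] is the 3-cycle      *)
(* p -> v p -> u p -> p.                                                      *)
Lemma commg_cycle3 (A U : {set T}) (u v : {perm T}) p :
    u \in Sym A -> v \in Sym U -> A :&: U = [set p] -> u p != p -> v p != p ->
  [~ u, v] = cycle3 p (v p) (u p).
Proof.
rewrite !inE => uA vU AU up vp.
have [pA pU] : p \in A /\ p \in U by apply/setIP; rewrite AU set11.
have notU x : x \in A -> x != p -> x \notin U.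
  by move=> xA; apply: contraNN => xU; rewrite -in_set1 -AU inE xA.
have upA : u p \in A by rewrite (perm_closed _ uA).
have vpU : v p \in U by rewrite (perm_closed _ vU).
have vpA : v p \notin A.
  by apply: contraNN vp => vpA; rewrite -in_set1 -AU inE vpA.
have u3 : uniq [:: p; v p; u p].
  by rewrite uniq3 ![p == _]eq_sym vp up; apply: contraNneq vpA => ->.
have vA x : x \in A -> x != p -> v x = x by move=> xA xp; rewrite (out_perm vU) ?notU.
have uN x : x \notin A -> u x = x by apply: out_perm.
apply/permP => x; rewrite commgEl conjgE 3!permM.
have [xA|xA] := boolP (x \in A); last first.
  have -> : u^-1 x = x by rewrite (out_perm (perm_onV uA)).
  have [->|xvp] := eqVneq x (v p); first by rewrite permK (vA _ upA up) cycle3_2.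
  have xp : x != p by apply: contraNneq xA => ->.
  have vx : v^-1 x \notin A.
    have [xU|xU] := boolP (x \in U); last by rewrite (out_perm (perm_onV vU)).
    have vxp : v^-1 x != p by apply: contraNneq xvp => <-; rewrite permKV.
    apply: contraTN xU => /notU/(_ vxp).
    by rewrite -(perm_closed _ vU) permKV.
  rewrite (uN _ vx) permKV cycle3D // !inE !negb_or xp xvp /=.
  by apply: contraNneq xA => ->.
have [->|xup] := eqVneq x (u p).
  rewrite permK cycle3_3 //.
  have wA : v^-1 p \notin A.
    have wU : v^-1 p \in U by rewrite -(perm_closed _ vU) permKV.
    apply: contraNN vp => wA; have: v^-1 p \in A :&: U by rewrite inE wA.
    by rewrite AU inE => /eqP wp; rewrite -{1}wp permKV.
  by rewrite (uN _ wA) permKV.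
have u1A : u^-1 x \in A by rewrite -(perm_closed _ uA) permKV.
have u1p : u^-1 x != p by apply: contraNneq xup => <-; rewrite permKV.
have -> : v^-1 (u^-1 x) = u^-1 x by rewrite -{1}(vA _ u1A u1p) permK.
rewrite permKV; have [->|xp] := eqVneq x p; first by rewrite cycle3_1.
rewrite vA // cycle3D // !inE !negb_or xp xup andbT /=.
by apply: contraNneq vpA => <-.
Qed.

End ThreeCycles.

Section SmallIndex.

Local Open Scope group_scope.

Variable T : finType.
Implicit Types (x y z : T) (U W X Y D : {set T}) (G L H : {group {perm T}}).

Lemma SymS U W : U \subset W -> Sym U \subset Sym W.
Proof. by move=> UW; apply/subsetP => s; rewrite !inE => /subset_trans; apply. Qed.

Lemma all_cycle3_Sym D : all_cycle3 D (Sym D).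
Proof. by apply/all_cycle3P => x y z xD yD zD _; apply: cycle3_on. Qed.

Lemma all_cycle3S D G L : G \subset L -> all_cycle3 D G -> all_cycle3 D L.
Proof.
move=> GL /all_cycle3P DG; apply/all_cycle3P => x y z xD yD zD u.
by apply: (subsetP GL); apply: DG.
Qed.

(** D has a third point z. The 3-cycle on x, y, z is oriented according to whether z lies in X, so
    that exactly x leaves X and y enters it. *)
Lemma cycle3_exchange D L X x y : 2 < #|D| -> all_cycle3 D L -> X \subset D ->
    x \in X -> y \in D -> y \notin X ->
  exists2 s, s \in L & s @: X = y |: X :\ x.
Proof.
move=> D2 /all_cycle3P DL XD xX yD yX.
have xD := subsetP XD _ xX.
have xy : x != y by apply: contraNneq yX => <-.
have /card_gt0P[z] : 0 < #|D :\: [set x; y]|.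
  by rewrite cardsD subn_gt0 (leq_ltn_trans (subset_leq_card (subsetIr _ _))) ?cards2 ?xy.
rewrite !inE negb_or => /andP[/andP[zx zy] zD].
have cardX : #|y |: X :\ x| = #|X|.
  by rewrite cardsU1 !inE (negPf yX) andbF (cardsD1 x X) xX.
have imX (s : {perm T}) : {in X, forall t, s t \in y |: X :\ x} -> s @: X = y |: X :\ x.
  move=> sX; apply/eqP; rewrite eqEcard cardX (card_imset _ perm_inj) leqnn andbT.
  by apply/subsetP => _ /imsetP[t tX ->]; apply: sX.
have [zX|zX] := boolP (z \in X).
  have u : uniq [:: x; z; y] by rewrite uniq3 eq_sym zx xy zy.
  exists (cycle3 x z y); first exact: DL.
  apply: imX => t tX; have [->|tx] := eqVneq t x; first by rewrite cycle3_1 // !inE zx zX orbT.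
  have [->|tz] := eqVneq t z; first by rewrite cycle3_2 !inE eqxx.
  rewrite cycle3D !inE ?negb_or ?tx ?tz ?tX ?orbT //=.
  by apply: contraNneq yX => <-.
have u : uniq [:: x; y; z] by rewrite uniq3 xy eq_sym zx eq_sym zy.
exists (cycle3 x y z); first exact: DL.
apply: imX => t tX; have [->|tx] := eqVneq t x; first by rewrite cycle3_1 // !inE eqxx.
rewrite cycle3D !inE ?negb_or ?tx ?tX ?orbT //=.
by apply/andP; split; [apply: contraNneq yX|apply: contraNneq zX] => <-.
Qed.

Lemma cycle3_set_trans D L X Y : 2 < #|D| -> all_cycle3 D L -> X \subset D ->
  Y \subset D -> #|X| = #|Y| -> exists2 s, s \in L & s @: X = Y.
Proof.
move=> D2 DL; have [k] := ubnP #|X :\: Y|; elim: k X => // k IHk X ltk XD YD XY.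
have [XsY|] := boolP (X \subset Y).
  exists 1; first exact: group1.
  rewrite (eq_imset (g := id)) ?imset_id; last by move=> t; rewrite perm1.
  by apply/eqP; rewrite eqEcard XsY XY /=.
case/subsetPn => x xX xY.
have /subsetPn[y yY yX] : ~~ (Y \subset X).
  apply: contraNN xY => YX; suff -> : Y = X by [].
  by apply/eqP; rewrite eqEcard YX XY /=.
have yD := subsetP YD _ yY.
have [s sL sX] := cycle3_exchange D2 DL XD xX yD yX.
have [||||t tL tX] := IHk (y |: X :\ x).
- rewrite -ltnS; apply: leq_trans ltk; rewrite ltnS [leqRHS](cardsD1 x) !inE xX xY ltnS.
  apply: subset_leq_card; apply/subsetP => t; rewrite !inE => /andP[tY /orP[/eqP ty|/andP[-> ->]]].
    by rewrite ty yY in tY.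
  by rewrite tY.
- apply/subsetP => t; rewrite !inE => /predU1P[->//|/andP[_]]; exact: (subsetP XD).
- exact: YD.
- by rewrite cardsU1 !inE (negPf yX) andbF -XY [RHS](cardsD1 x) xX.
exists (s * t); first exact: groupM.
rewrite -tX -sX -imset_comp; apply: eq_imset => u /=; exact: permM.
Qed.

Lemma card_orbit_cycle3 D L X : 2 < #|D| -> all_cycle3 D L -> L \subset Sym D ->
  X \subset D -> #|orbit 'P^* L X| = 'C(#|D|, #|X|).
Proof.
move=> D2 DL LD XD; rewrite -cards_draws; apply: eq_card => Y; rewrite [RHS]inE.
apply/orbitP/andP => [[s sL <-]|[YD /eqP XY]].
  have := subsetP LD _ sL; rewrite inE => sD; split; last first.
    by rewrite (card_imset _ perm_inj).
  by apply/subsetP => _ /imsetP[t tX ->]; rewrite (perm_closed _ sD) (subsetP XD).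
by have [s sL sX] := cycle3_set_trans D2 DL XD YD (esym XY); exists s.
Qed.

(** * Invariant sets and orbits of subgroups of small index *)

Lemma leq_index_Sym U W G : U \subset W -> #|Sym U : G| <= #|Sym W : G|.
Proof. by move=> UW; apply: subset_leq_card; apply: imsetS; apply: SymS. Qed.

(** [G :&: Sym U] lies in the setwise stabilizer of Y, whose index in [Sym U] is the number of
    subsets of U of size #|Y|. *)
Lemma leq_bin_index U Y G : 2 < #|U| -> Y \subset U ->
  {in G :&: Sym U, forall s : {perm T}, s @: Y = Y} -> 'C(#|U|, #|Y|) <= #|Sym U : G|.
Proof.
move=> U2 YU GY; rewrite -(card_orbit_cycle3 U2 (all_cycle3_Sym U)) //.
rewrite card_orbit -(indexgI (Sym_group U) G).
apply: dvdn_leq => //; apply: indexgS.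
apply/subsetP => s sGU; have /setIP[sU sG] := sGU.
rewrite inE sU; apply/astab1P; apply: GY; by rewrite inE sG.
Qed.

(** An invariant set is tiny or almost everything: an intermediate size would force, by unimodality
    of the binomials, an index of at least 'C(#|U|, j.+1). *)
Lemma invariant_small U Y G j : 2 < #|U| -> #|Sym U : G| < 'C(#|U|, j.+1) -> Y \subset U ->
    {in G :&: Sym U, forall s : {perm T}, s @: Y = Y} ->
  #|Y| + j < #|U| -> #|Y| <= j.
Proof.
move=> U2 ltS YU GY ltU; rewrite leqNgt; apply/negP => jY.
have := leq_bin_index U2 YU GY; rewrite leqNgt (leq_trans ltS) //.
by apply: leq_bin_unimodal => //; lia.
Qed.

(** Take a largest invariant set Y of size at most j, and p outside Y. If the orbit of p were not
    almost all of U, it would have at most j points. Its union with Y would be invariant with at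
    most 2j points, hence again at most j, against maximality. *)
Lemma big_orbit U G j : 2 < #|U| -> 3 * j < #|U| -> #|Sym U : G| < 'C(#|U|, j.+1) ->
  exists2 p, p \in U & #|U| <= #|orbit 'P (G :&: Sym U) p| + j.
Proof.
move=> U2 U3 ltS.
pose P Y := [&& Y \subset U, #|Y| <= j & [forall s in G :&: Sym U, s @: Y == Y]].
have P0 : P set0.
  by rewrite /P sub0set cards0 /=; apply/forall_inP => s _; rewrite imset0.
case: (@arg_maxnP _ set0 P (fun Y => #|Y|) P0) => Y /and3P[YU Yj /forall_inP GY] maxY.
have /card_gt0P[p] : 0 < #|U :\: Y|.
  by rewrite cardsD (setIidPr YU) subn_gt0; apply: leq_ltn_trans Yj _; lia.
rewrite inE => /andP[pY pU]; exists p => //.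
set O := orbit _ _ p.
have OU : O \subset U.
  apply/subsetP => _ /orbitP[s /setIP[_ sU] <-].
  by rewrite /= apermE (perm_closed _) //; rewrite inE in sU.
have pO : p \in O by apply: orbit_refl.
have GO : {in G :&: Sym U, forall s : {perm T}, s @: O = O}.
  move=> s sG; apply/eqP; rewrite eqEcard (card_imset _ perm_inj) leqnn andbT.
  apply/subsetP => _ /imsetP[_ /orbitP[r rG <-] ->]; apply/orbitP.
  by exists (r * s); [apply: groupM | rewrite actM].
rewrite leqNgt; apply/negP => ltO.
have Oj := invariant_small U2 ltS OU GO ltO.
have YO : #|Y :|: O| <= #|Y| + #|O| by rewrite -cardsUI leq_addr.
have YOG : {in G :&: Sym U, forall s : {perm T}, s @: (Y :|: O) = Y :|: O}.
  by move=> s sG; rewrite imsetU GO // (eqP (GY _ sG)).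
have YOU : Y :|: O \subset U by rewrite subUset YU.
have YOj : #|Y :|: O| <= j.
  apply: (invariant_small U2 ltS YOU YOG).
  by lia.
have := maxY (Y :|: O); rewrite /P YOU YOj /=.
have -> : [forall s in G :&: Sym U, s @: (Y :|: O) == Y :|: O].
  by apply/forall_inP => s sG; rewrite YOG.
move=> /(_ isT); rewrite leqNgt; case/negP; apply: proper_card.
by apply/properP; split; [exact: subsetUl|exists p; rewrite // inE pO orbT].
Qed.

End SmallIndex.

Section Support.

Local Open Scope group_scope.

Variable T : finType.
Implicit Types (x y z p : T) (U W X Y A B : {set T}) (G : {group {perm T}}).

(** Pairs (B, p) with p outside B correspond to pairs (U, p) with p in U, through U = p |: B. *)
Lemma sum_draws W b (f : {set T} -> T -> nat) :
  (\sum_(B : {set T} | (B \subset W) && (#|B| == b)) \sum_(p in W :\: B) f (p |: B) p =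
   \sum_(U : {set T} | (U \subset W) && (#|U| == b.+1)) \sum_(p in U) f U p)%N.
Proof.
rewrite (exchange_big_dep (mem W)) /=; last by move=> B p _; rewrite inE => /andP[].
rewrite [RHS](exchange_big_dep (mem W)) /=; last first.
  by move=> U p /andP[/subsetP UW _]; apply: UW.
apply: eq_bigr => p pW.
rewrite [RHS](reindex_onto (fun B => p |: B) (fun U => U :\ p)) /=; last first.
  by move=> U /andP[_ pU]; rewrite setD1K.
apply: eq_bigl => B; rewrite !inE pW andbT eqxx /= subUset sub1set pW /= andbT.
have [pB|pB] := boolP (p \in B); rewrite ?andbF ?andbT.
  apply/esym/negbTE; rewrite negb_and; apply/orP; right.
  by apply: contraTneq pB => <-; rewrite !inE eqxx.
by rewrite setU1K // eqxx andbT cardsU1 pB.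
Qed.

Definition moved G U p := [exists v in G :&: Sym U, v p != p].

(** An unmoved point is an orbit by itself, so it lies outside the big orbit. *)
Lemma card_unmoved U G j : 2 < #|U| -> 3 * j < #|U| ->
  #|Sym U : G| < 'C(#|U|, j.+1) -> #|[set p in U | ~~ moved G U p]| <= j.
Proof.
move=> U2 U3 ltS; have [a aU] := big_orbit U2 U3 ltS; set O := orbit _ _ a => Oj.
have OU : O \subset U.
  apply/subsetP => _ /orbitP[s /setIP[_ sU] <-].
  by rewrite /= apermE (perm_closed _) //; rewrite inE in sU.
have UO : #|U :\: O| <= j by rewrite cardsD (setIidPr OU); lia.
apply: leq_trans UO; apply: subset_leq_card; apply/subsetP => p.
rewrite !inE => /andP[pU pn]; rewrite pU andbT.
apply: contraNN pn => pO; apply: contraT => /exists_inPn pn.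
have Op : O = orbit 'P (G :&: Sym U) p by apply/esym/orbit_eqP.
have : O \subset [set p].
  rewrite Op; apply/subsetP => _ /orbitP[s sG <-].
  by have := pn s sG; rewrite negbK inE.
by move=> /subset_leq_card; rewrite cards1; lia.
Qed.

(* Double counting of the pairs (U, p) where |U| = |W|/3 + 1 and the elements *)
(* of G supported on U all fix p.                                             *)
Lemma exists_moved W G j : 5 < #|W| -> 3 * j <= #|W| %/ 3 ->
    #|Sym W : G| < 'C(#|W| %/ 3, j.+1) ->
  exists B, [/\ B \subset W, #|B| = #|W| %/ 3 &
    #|[set p in W :\: B | ~~ moved G (p |: B) p]| <= 2 * j].
Proof.
move=> W5 W3 ltS; set b := #|W| %/ 3 in W3 ltS *.
have b2 : 1 < b by rewrite /b; lia.
have b3 : #|W| < 3 * b.+1 by rewrite /b; lia.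
have [/existsP[B /and3P[BW /eqP Bb Bj]]|/existsPn none] := boolP [exists B : {set T},
  [&& B \subset W, #|B| == b & #|[set p in W :\: B | ~~ moved G (p |: B) p]| <= 2 * j]].
  by exists B.
have card_b : 0 < 'C(#|W|, b) by rewrite bin_gt0 leq_div.
pose f U p := ~~ moved G U p : nat.
have lo : 'C(#|W|, b) * (2 * j).+1 <=
    \sum_(B : {set T} | (B \subset W) && (#|B| == b)) \sum_(p in W :\: B) f (p |: B) p.
  rewrite -cards_draws -sum_nat_const big_mkcond [leqRHS]big_mkcond /=.
  apply: leq_sum => B _; rewrite inE; case: ifP => // /andP[BW Bb].
  have := none B; rewrite BW Bb /= -ltnNge => /leq_trans; apply.
  rewrite -sum1_card big_mkcond [leqRHS]big_mkcond /=; apply: leq_sum => p _.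
  by rewrite !inE /f; case: (_ && (p \in W)) => //=; case: moved.
have hi : \sum_(U : {set T} | (U \subset W) && (#|U| == b.+1)) \sum_(p in U) f U p
    <= 'C(#|W|, b.+1) * j.
  rewrite -cards_draws -sum_nat_const big_mkcond [leqRHS]big_mkcond /=.
  apply: leq_sum => U _; rewrite inE; case: ifP => // /andP[UW /eqP Ub].
  apply: leq_trans (@card_unmoved U G j _ _ _); rewrite ?Ub //; last first.
    apply: leq_ltn_trans (leq_index_Sym G UW) (leq_trans ltS _).
    by apply: leq_bin2l.
  rewrite -sum1_card big_mkcond [leqRHS]big_mkcond /=; apply: leq_sum => p _.
  by rewrite !inE /f; case: (p \in U) => //=; case: moved.
(* The two counts contradict each other: (b+1) 'C(#|W|, b+1) = (#|W| - b) 'C(#|W|, b), and #|W| - b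
   <= 2(b+1) since #|W| < 3(b+1). *)
rewrite sum_draws in lo; have := leq_trans lo hi => {lo hi none}.
rewrite -(leq_pmul2l (ltn0Sn b)) [leqRHS]mulnA mul_bin_left.
suff : ((#|W| - b) * 'C(#|W|, b) * j < b.+1 * ('C(#|W|, b) * (2 * j).+1))%N by lia.
by move: card_b b3; move: 'C(_, _) => c; nia.
Qed.

(** Let A = W :\: B for the B of [exists_moved]. Some p in the big orbit O of [G :&: Sym A] is moved
    to q in B by an element v of G supported on p |: B. Commutators of v with elements of G
    supported on A give [cycle3 p q z] for z in O other than p. A maximal X carrying all 3-cycles
    and containing p and q then contains O. It is also G-invariant, so [invariant_small] bounds its
    complement by j. *)
Theorem small_index_support W G j : 5 < #|W| -> G \subset Sym W ->
    3 * j <= #|W| %/ 3 -> #|Sym W : G| < 'C(#|W| %/ 3, j.+1) ->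
  exists X, [/\ X \subset W, #|W| <= #|X| + j, all_cycle3 X G &
    {in G, forall s : {perm T}, s @: X = X}].
Proof.
move=> W5 GW W3 ltS.
have [B [BW cardB Bj]] := exists_moved W5 W3 ltS.
set b := #|W| %/ 3 in W3 ltS cardB.
have b2 : 1 < b by rewrite /b; lia.
have b3 : 3 * b <= #|W| by rewrite /b; lia.
pose A := W :\: B.
have cardA : #|A| = #|W| - b by rewrite cardsD (setIidPr BW) cardB.
have [|||a aA] := @big_orbit _ A G j; rewrite ?cardA; try lia.
  apply: leq_ltn_trans (leq_index_Sym G (subsetDl W B)) (leq_trans ltS _).
  by apply: leq_bin2l; lia.
set O := orbit _ _ a => cardO.
have OA : O \subset A.
  apply/subsetP => _ /orbitP[s /setIP[_ sA] <-].
  by rewrite /= apermE (perm_closed _) //; rewrite inE in sA.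
have [p pO pm] : exists2 p, p \in O & moved G (p |: B) p.
  apply/exists_inP; apply: contraT => /exists_inPn noO.
  have /subset_leq_card : O \subset [set p in W :\: B | ~~ moved G (p |: B) p].
    by apply/subsetP => p pO; rewrite inE (subsetP OA) //= noO.
  by move: Bj cardA cardO W3 b2 b3; clear; lia.
have pA := subsetP OA _ pO.
have [pB pW] : p \notin B /\ p \in W by move: pA; rewrite inE => /andP[].
case/exists_inP: pm => v /setIP[vG vB] vp.
pose q := v p.
have qB : q \in B.
  have : q \in p |: B.
    by rewrite /q (perm_closed _) ?setU11 //; move: vB; rewrite inE.
  by rewrite in_setU1 (negPf vp).
have qA : q \notin A by rewrite inE qB.
have AB : A :&: (p |: B) = [set p].
  apply/setP => z; rewrite !inE; have [->|zp] := eqVneq z p; first by rewrite pB pW.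
  by case: (z \in B); rewrite ?andbF.
have Oc z : z \in O -> z != p -> cycle3 p q z \in G.
  move=> zO zp.
  have /orbitP[u /setIP[uG uA] uz] : z \in orbit 'P (G :&: Sym A) p.
    by move: zO; rewrite /O => zO; rewrite (orbit_eqP pO : orbit 'P (G :&: Sym A) p = _).
  rewrite /= apermE in uz.
  have up : u p != p by rewrite uz.
  by rewrite -uz -(commg_cycle3 uA vB AB up vp) groupR.
pose P X := [&& X \subset W, p \in X, q \in X & all_cycle3 X G].
have P0 : P [set p; q].
  rewrite /P subUset !sub1set pW (subsetP BW) // !inE !eqxx orbT /=.
  apply/all_cycle3P => x y z; rewrite !inE uniq3.
  by do 3!case/orP=> /eqP->; rewrite ?eqxx ?andbF.
case: (@arg_maxnP _ [set p; q] P (fun Y => #|Y|) P0) => X /and4P[XW pX qX fX] maxX.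
have maxX' z : z \in W -> all_cycle3 (z |: X) G -> z \in X.
  move=> zW fz; apply: contraT => zX.
  have /maxX : P (z |: X) by rewrite /P subUset sub1set zW XW !in_setU1 pX qX !orbT.
  by rewrite /= cardsU1 zX /= ltnn.
have extX x y z : x \in X -> y \in X -> x != y -> z \in W -> cycle3 x y z \in G -> z \in X.
  move=> xX yX xy zW xyz; apply: contraT => zX; rewrite -(negbTE zX).
  by apply: maxX' => //; apply: (all_cycle3_ext fX xX yX zX xy xyz).
have OX : q |: O \subset X.
  rewrite subUset sub1set qX; apply/subsetP => z zO.
  have [->//|zp] := eqVneq z p.
  apply: (extX p q) => //; rewrite 1?eq_sym ?Oc //.
  by have := subsetP OA _ zO; rewrite inE => /andP[].
have cardX : #|W| - b - j < #|X|.
  have := subset_leq_card OX; rewrite cardsU1.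
  have -> /= : q \notin O by apply: contraNN qA; apply: (subsetP OA).
  by move: cardA cardO; clear; lia.
(* By size, X and s @: X share two points x, y. For z in s @: X, [cycle3 x y z] is the conjugate by
   s of a 3-cycle on X, hence in G, and maximality puts z in X. *)
have XG : {in G, forall s : {perm T}, s @: X = X}.
  move=> s sG; apply/eqP; rewrite eqEcard (card_imset _ perm_inj) leqnn andbT.
  have sW : s @: W = W by apply: im_perm_on; have := subsetP GW _ sG; rewrite inE.
  have YW : s @: X \subset W by rewrite -sW imsetS.
  have [x [y [xI yI xy]]] : exists x y, [/\ x \in X :&: s @: X, y \in X :&: s @: X & x != y].
    have /card_gt1P[x [y [xI yI xy]]] : 1 < #|X :&: s @: X|; last by exists x, y.
    have := cardsUI X (s @: X); rewrite (card_imset _ perm_inj).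
    have /subset_leq_card : X :|: s @: X \subset W by rewrite subUset XW.
    by move: cardX b3 W3 b2; clear; lia.
  have /setIP[xX xY] := xI; have /setIP[yX yY] := yI.
  apply/subsetP => z zY; have zW := subsetP YW _ zY.
  have [->//|zx] := eqVneq z x; have [->//|zy] := eqVneq z y.
  apply: (extX x y) => //.
  case/imsetP: xY xy zx => x' x'X ->; case/imsetP: yY zy => y' y'X ->.
  case/imsetP: zY => z' z'X ->; rewrite !(inj_eq (@perm_inj _ s)) => zy xy zx.
  rewrite -cycle3J groupJr //; move/all_cycle3P: fX; apply => //.
  by rewrite uniq3 xy eq_sym zx eq_sym zy.
exists X; split=> //; rewrite leqNgt; apply/negP => ltX.
have : #|X| <= j; last by move: cardX b3 W3 b2; clear; lia.
apply: (@invariant_small _ W X G) => //; first by move: W5; clear; lia.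
  by apply: leq_trans ltS _; apply: leq_bin2l; rewrite /b leq_div.
by move=> s /setIP[sG _]; apply: XG.
Qed.

End Support.

(** * Symmetric circuits *)

Section OrbitSum.

Variables (aT : finGroupType) (T : finType) (to : {action aT &-> T}).

Lemma dvdn_sum_orbits (G : {group aT}) m (f : T -> nat) :
    {in G, forall a x, f (to x a) = f x} ->
  m %| \sum_(x | m %| #|orbit to G x|) f x.
Proof.
move=> fG; rewrite (partition_big (orbit to G) xpredT) //=.
apply: dvdn_sum => O _.
have [x /andP[mx /eqP xO]|none] := pickP [pred x | (m %| #|orbit to G x|) && (orbit to G x == O)];
  last by rewrite big_pred0.
rewrite (eq_bigl (mem (orbit to G x))) => [|y]; last first.
  apply/andP/idP => [[_ /eqP yO]|/= yx]; first by rewrite /= xO -yO orbit_refl.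
  have <- : orbit to G x = orbit to G y by apply/orbit_eqP; rewrite orbit_sym.
  by rewrite mx xO.
rewrite (eq_bigr (fun=> f x)) => [|_ /orbitP[a aG <-]]; last exact: fG.
by rewrite sum_nat_const dvdn_mulr.
Qed.

End OrbitSum.

Lemma eq_MOD m (R : {set 'Z_m}) s t : 1 < m -> s = t %[mod m] -> MOD R s = MOD R t.
Proof.
by move=> m1 st; congr (_ \in R); apply: val_inj; rewrite /= !val_Zp_nat.
Qed.

Section SymmetricCircuit.

Variables (m n : nat) (C : circuit m n).

Local Notation autT := ({perm gate C} * 'S_n)%type.

Definition relabel (pi : 'S_n) (l : 'I_n + {set 'Z_m}) : 'I_n + {set 'Z_m} :=
  match l with inl i => inl (pi i) | inr R => inr R end.

(** The permutation of the inputs is kept as a second component, so that passing to 'S_n is the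
    projection morphism [snd]. *)
Definition circuit_aut : {set autT} :=
  [set u : autT | [forall g, label (u.1 g) == relabel u.2 (label g)]
                  && [forall g, forall h, wires (u.1 g) (u.1 h) == wires g h]].

Lemma circuit_autP (u : autT) :
  reflect ((forall g, label (u.1 g) = relabel u.2 (label g)) /\
           (forall g h, wires (u.1 g) (u.1 h) = wires g h))
          (u \in circuit_aut).
Proof.
rewrite inE; apply: (iffP andP) => [[/forallP l /forallP w]|[l w]].
  by split=> [g|g h]; [apply/eqP | move/forallP: (w g) => /(_ h)/eqP].
split; apply/forallP => g; first by rewrite l.
by apply/forallP => h; rewrite w.
Qed.

Lemma circuit_aut_group_set : group_set circuit_aut.
Proof.
apply/group_setP; split=> [|u v /circuit_autP[lu wu] /circuit_autP[lv wv]].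
  apply/circuit_autP; split=> [g|g h]; rewrite !perm1 //.
  by case: (label g) => // i; rewrite /= perm1.
apply/circuit_autP; split=> [g|g h]; rewrite !permM ?wv //.
by rewrite lv lu; case: (label g) => //= i; rewrite permM.
Qed.
Canonical circuit_aut_group := Group circuit_aut_group_set.

Definition gate_act (g : gate C) (u : autT) : gate C := u.1 g.

Lemma gate_act1 : gate_act^~ 1%g =1 id.
Proof. by move=> g; rewrite /gate_act perm1. Qed.

Lemma gate_actM g : act_morph gate_act g.
Proof. by move=> u v; rewrite /gate_act permM. Qed.

Definition gate_action := TotalAction gate_act1 gate_actM.

Definition gate_stab (g : gate C) : {group 'S_n} :=
  [group of (@snd _ _ @* 'C_circuit_aut[g | gate_action])%g].

Lemma gate_val_rec_aut u x k (g : gate C) : u \in circuit_aut ->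
  gate_val_rec x k (u.1 g) = gate_val_rec [ffun i => x (u.2 i)] k g.
Proof.
move=> /circuit_autP[lu wu]; elim: k g => // k IHk g /=.
rewrite lu; case: (label g) => [i|R] /=; first by rewrite ffunE.
congr MOD; rewrite (reindex_inj (@perm_inj _ u.1)) /=.
by apply: eq_bigr => h _; rewrite wu IHk.
Qed.

Hypothesis symC : symmetric_circuit [set: 'S_n]%G C.

Lemma snd_circuit_aut : (@snd _ _ @* circuit_aut)%g = [set: 'S_n].
Proof.
apply/setP => pi; rewrite inE; have [s [sl sw] si] := symC (in_setT pi).
apply/morphimP; exists (s, pi); rewrite ?inE //=; apply/andP; split; last first.
  by apply/forallP => g; apply/forallP => h; rewrite /= sw.
apply/forallP => g; case E: (label g) => [i|R] /=; first by rewrite (si _ _ E).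
by rewrite (sl _ _ E).
Qed.

(** The orbit of g has at most #|gate C| elements, and projecting to 'S_n, which is onto by
    symmetry, does not increase the index. *)
Lemma index_gate_stab g : #|Sym [set: 'I_n] : gate_stab g|%g <= #|gate C|.
Proof.
have -> : Sym [set: 'I_n] = [set: 'S_n].
  by apply/setP => s; rewrite !inE; apply/subsetP => i _; rewrite inE.
rewrite -snd_circuit_aut; apply: leq_trans (max_card (orbit gate_action circuit_aut g)).
by rewrite card_orbit; apply: dvdn_leq => //; apply: index_morphim; apply: subsetT.
Qed.

(** * Children of a gate fixed by the 3-cycles on D *)

Section Step.

Variables (D : {set 'I_n}) (j : nat) (x : {ffun 'I_n -> bool}) (g : gate C).
Hypothesis D5 : 5 < #|D|.
Hypothesis j_small : 3 * j <= #|D| %/ 3.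
Hypothesis size_small : #|gate C| ^ 2 < 'C(#|D| %/ 3, j.+1).
Hypothesis dvd_bin : forall t, 0 < t <= j -> m %| 'C(#|D|, t).
Hypothesis g_inv : all_cycle3 D (gate_stab g).

Definition local_aut : {group autT} :=
  [group of ('C_circuit_aut[g | gate_action] :&: @snd _ _ @*^-1 Sym D)%g].

Lemma local_autP u : u \in local_aut ->
  [/\ u \in circuit_aut, u.1 g = g & u.2 \in Sym D].
Proof.
case/setIP=> /setIP[uA /astab1P ug] /morphpreP[_ uD].
by split.
Qed.

Lemma cycle3_local_aut : all_cycle3 D (@snd _ _ @* local_aut)%g.
Proof.
apply/all_cycle3P => a b c aD bD cD u.
have /all_cycle3P/(_ a b c aD bD cD u) := g_inv.
case/morphimP => v _ vg vE; apply/morphimP; exists v; rewrite ?in_setT //.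
apply/setIP; split=> //; apply/morphpreP; split; first exact: in_setT.
by rewrite -[X in X \in _]vE cycle3_on.
Qed.

Lemma index_local_aut : #|Sym D : (@snd _ _ @* local_aut)%g|%g <= #|gate C|.
Proof.
apply: leq_trans (index_gate_stab g).
apply: leq_trans (leq_index_Sym (gate_stab g) (subsetT D)).
rewrite -(indexgI (Sym_group D) (gate_stab g)); apply: dvdn_leq => //; apply: indexgS.
apply/subsetP => pi /setIP[piD] /morphimP[v _ vg vE]; apply/morphimP.
exists v; rewrite ?in_setT //; apply/setIP; split=> //; apply/morphpreP.
by split; [exact: in_setT | rewrite -[X in X \in _]vE].
Qed.

(** The projected stabilizer H of h has index at most #|gate C| ^ 2 in [Sym D], one factor for
    fixing g and one for fixing h. So H preserves some X missing at most j points of D and contains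
    the 3-cycles on X. If X is not D, the orbit of X under L has size 'C(#|D|, #|D| - #|X|), a
    multiple of m. It divides the index of H in L, which divides the orbit size of h. *)
Lemma orbit_local_aut h : ~~ (m %| #|orbit gate_action local_aut h|) ->
  all_cycle3 D (gate_stab h).
Proof.
move=> m_ndvd.
pose L := [group of (@snd _ _ @* local_aut)%g].
pose H := [group of (@snd _ _ @* 'C_local_aut[h | gate_action])%g].
have HL : H \subset L by apply: morphimS; apply: subsetIl.
have LD : L \subset Sym D by apply/subsetP => _ /morphimP[u _ /local_autP[_ _ ?] ->].
have LH : #|L : H|%g %| #|orbit gate_action local_aut h|.
  by rewrite card_orbit; apply: index_morphim; apply: subsetT.
have LH_le : #|L : H|%g <= #|gate C|.
  apply: leq_trans (max_card (orbit gate_action local_aut h)).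
  by apply: dvdn_leq LH; rewrite card_orbit.
have DH : #|Sym D : H|%g < 'C(#|D| %/ 3, j.+1).
  apply: leq_ltn_trans size_small; rewrite -(Lagrange_index LD HL) -mulnn.
  by apply: leq_mul LH_le; apply: index_local_aut.
have [X [XD cardX XH Xinv]] := small_index_support D5 (subset_trans HL LD) j_small DH.
have H_stab : H \subset gate_stab h.
  apply: morphimS; apply: setSI; apply/subsetP => u /local_autP[]//.
have [DX|DX] := eqVneq X D; first by rewrite -DX (all_cycle3S H_stab).
case/negP: m_ndvd; apply: dvdn_trans LH.
have ltXD : #|X| < #|D| by apply: proper_card; rewrite properEneq DX.
have : m %| #|orbit 'P^* L X|.
  rewrite (card_orbit_cycle3 _ cycle3_local_aut) //; last by apply: leq_trans D5.
  by rewrite -bin_sub ?dvd_bin //; [move: cardX ltXD; clear; lia | apply: ltnW].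
move/dvdn_trans; apply; rewrite card_orbit; apply: indexgS.
apply/subsetP => s sH; rewrite inE (subsetP HL) //=; apply/astab1P.
exact: Xinv.
Qed.

Hypothesis x_const : {in D &, forall i i', x i = x i'}.

Lemma dvdn_sum_local_aut k : m %| \sum_(h | m %| #|orbit gate_action local_aut h|)
    wires g h * gate_val_rec x k h.
Proof.
apply: dvdn_sum_orbits => u /local_autP[uA ug uD] h /=.
have /circuit_autP[_ uw] := uA.
rewrite /gate_act -{1}ug uw gate_val_rec_aut //; congr (_ * gate_val_rec _ _ _).
apply/ffunP => i; rewrite ffunE; rewrite inE in uD.
have [iD|iD] := boolP (i \in D); last by rewrite (out_perm uD iD).
by apply: x_const; rewrite // (perm_closed _ uD).
Qed.

End Step.

(* Among the children of g, those not fixed by the 3-cycles on D contribute 0 *)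
(* mod m, since they come in orbits whose sizes are multiples of m.           *)
Lemma gate_val_block (D : {set 'I_n}) j (x x' : {ffun 'I_n -> bool}) k g :
    1 < m -> 5 < #|D| -> 3 * j <= #|D| %/ 3 ->
    #|gate C| ^ 2 < 'C(#|D| %/ 3, j.+1) ->
    (forall t, 0 < t <= j -> m %| 'C(#|D|, t)) ->
    {in D &, forall i i', x i = x i'} -> {in D &, forall i i', x' i = x' i'} ->
    (forall i, i \notin D -> x i = x' i) ->
  all_cycle3 D (gate_stab g) -> gate_val_rec x k g = gate_val_rec x' k g.
Proof.
move=> m1 D5 jD sD mD xD x'D xx'; elim: k g => // k IHk g gD /=.
case E: (label g) => [i|R].
  (* An input gate labelled i in D would be moved by a 3-cycle through i. *)
  apply: xx'; apply/negP => iD.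
  have /card_gt1P[a [b [aD bD ab]]] : 1 < #|D :\ i|.
    by move: D5; rewrite (cardsD1 i D) iD add1n ltnS; apply: leq_trans.
  move: aD bD; rewrite !inE => /andP[ai aD] /andP[bi bD].
  have u : uniq [:: i; a; b] by rewrite uniq3 eq_sym ai eq_sym bi ab.
  have /all_cycle3P/(_ i a b iD aD bD u) := gD.
  case/morphimP => v _ /setIP[/circuit_autP[vl _] /astab1P vg] vE.
  have := vl g; rewrite [v.1 g]vg E /= => -[] iE; case/eqP: ai.
  by rewrite -(cycle3_1 u) vE -iE.
apply: eq_MOD => //.
rewrite (bigID (fun h => m %| #|orbit gate_action (local_aut D g) h|)) /=.
rewrite [in RHS](bigID (fun h => m %| #|orbit gate_action (local_aut D g) h|)) /=.
rewrite -modnDml -[in RHS]modnDml; congr ((_ + _) %% m).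
  have := dvdn_sum_local_aut g xD k; have := dvdn_sum_local_aut g x'D k.
  by rewrite /dvdn => /eqP-> /eqP->.
by apply: eq_bigr => h hm; rewrite (IHk h (orbit_local_aut D5 jD sD mD gD hm)).
Qed.

(** The output gate respects the 3-cycles on a set missing at most j inputs, which has room for a D
    of size M. Switching D from ones to zeros would then leave the output unchanged. *)
Lemma symmetric_AND_lower M j : 1 < m -> computes C (@AND n) -> M + j <= n -> 5 < M ->
    3 * j <= M %/ 3 -> (forall t, 0 < t <= j -> m %| 'C(M, t)) ->
  'C(M %/ 3, j.+1) <= #|gate C| ^ 2.
Proof.
move=> m1 andC Mn M5 jM mM; rewrite leqNgt; apply/negP => sM.
have gate_gt0 : 0 < #|gate C| by apply/card_gt0P; exists (output C).
have le3 : M %/ 3 <= n %/ 3 by apply: leq_div2r; lia.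
have [||||X [_ Xn XG _]] := @small_index_support _ [set: 'I_n] (gate_stab (output C)) j;
  rewrite ?cardsT ?card_ord.
- by lia.
- by apply/subsetP => s _; rewrite inE; apply/subsetP => i _; rewrite inE.
- exact: leq_trans le3.
- apply: leq_ltn_trans (index_gate_stab _) _; apply: leq_trans (leq_bin2l _ le3).
  by apply: leq_ltn_trans sM; rewrite -mulnn leq_pmulr.
rewrite cardsT card_ord in Xn.
have /card_gt0P[D] : 0 < #|[set D : {set 'I_n} | D \subset X & #|D| == M]|.
  by rewrite cards_draws bin_gt0; lia.
rewrite inE => /andP[DX /eqP cardD].
have DG : all_cycle3 D (gate_stab (output C)).
  apply/all_cycle3P => a b c aD bD cD; move/all_cycle3P: XG; apply; exact: (subsetP DX).
have /card_gt0P[i iD] : 0 < #|D| by rewrite cardD; lia.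
have := @gate_val_block D j [ffun=> true] [ffun i => i \notin D] #|gate C| (output C) m1.
rewrite cardD => /(_ M5 jM sM mM) val_eq.
have : gate_val [ffun=> true] (output C) = gate_val [ffun i => i \notin D] (output C).
  by apply: val_eq => // [a b|a b aD bD|a aD]; rewrite !ffunE ?aD ?bD.
rewrite !andC => and_eq; have /forallP/(_ i) : AND [ffun i => i \notin D].
  by rewrite -and_eq; apply/'forall_idP => a; rewrite ffunE.
by rewrite ffunE iD.
Qed.

End SymmetricCircuit.

(** * Binomial coefficients and congruences *)

Lemma natr_Zp_eq d a b : 1 < d -> (a%:R == b%:R :> 'Z_d)%R = (a == b %[mod d]).
Proof. by move=> d1; rewrite -(inj_eq val_inj) /= !val_Zp_nat. Qed.

(** From t 'C(M, t) = M 'C(M-1, t-1), the q-adic valuation of M is at most that of t plus that of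
    'C(M, t). *)
Lemma dvdn_bin_pfactor q e M t : prime q -> 0 < t <= M -> logn q t + e <= logn q M ->
  q ^ e %| 'C(M, t).
Proof.
move=> qpr /andP[t0 tM] tM_log; rewrite pfactor_dvdn ?bin_gt0 //.
rewrite -(leq_add2l (logn q t)); apply: leq_trans tM_log _.
case: t t0 tM => // t _ tM; have M0 : 0 < M by apply: leq_trans tM.
rewrite -lognM ?bin_gt0 // -mul_bin_diag lognM ?leq_addr // bin_gt0.
by rewrite -ltnS (ltn_predK tM).
Qed.

Lemma dvdn_bin_pow q k t : prime q -> 0 < t < q ^ k -> q %| 'C(q ^ k, t).
Proof.
move=> qpr /andP[t0 tQ]; rewrite -[X in X %| _]expn1.
apply: dvdn_bin_pfactor => //; first by rewrite t0 ltnW.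
rewrite pfactorK // addn1 -(ltn_exp2l _ _ (prime_gt1 qpr)).
by apply: leq_ltn_trans tQ; apply: dvdn_leq => //; apply: pfactor_dvdnn.
Qed.

Section AlternatingSum.

Local Open Scope ring_scope.

Variables (q k : nat).
Hypothesis q_prime : prime q.

Let q1 : (1 < q)%N := prime_gt1 q_prime.
Let Q := (q ^ k)%N.

Lemma natr_dvd (a : nat) : (q %| a)%N -> a%:R = 0 :> 'Z_q.
Proof. by case/dvdnP=> b ->; rewrite natrM pchar_Zp // mulr0. Qed.

(** In Vandermonde's sum, q divides 'C(Q, i) for 0 < i < Q, so only the term i = 0 survives. *)
Lemma bin_periodic w j : (j < Q)%N -> 'C(Q + w, j)%:R = 'C(w, j)%:R :> 'Z_q.
Proof.
move=> jQ; rewrite -binomial.Vandermonde big_ord_recl /= bin0 mul1n subn0 natrD natr_sum.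
rewrite big1 ?addr0 // => i _; rewrite natrM natr_dvd ?mul0r // dvdn_bin_pow //.
by apply: leq_trans jQ; rewrite ltnS /bump add1n ltn_ord.
Qed.

(* (1 - X)^(w + Q) = (1 - X)^w (1 - X^Q) mod q, so the sum has period Q in w. *)
Lemma alternating_bin_sum w :
  \sum_(j < Q) (-1) ^+ j * 'C(w, j)%:R = (Q %| w)%N%:R :> 'Z_q.
Proof.
have Q0 : (0 < Q)%N by rewrite expn_gt0 prime_gt0.
have [N] := ubnP w; elim: N w => // N IHN w wN.
have [Qw|wQ] := leqP Q w.
  rewrite -[w](subnKC Qw) dvdn_addr //= -IHN; last first.
    by rewrite -ltnS (leq_trans _ wN) // ltnS -subn_gt0 subKn.
  by apply: eq_bigr => j _; rewrite bin_periodic.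
have [->|w0] := posnP w.
  rewrite dvdn0 -(prednK Q0) big_ord_recl expr0 bin0 mul1r big1 ?addr0 // => i _.
  by rewrite bin0n mulr0.
(* For 0 < w < Q the terms beyond j = w vanish, and the rest is (1 - 1)^w = 0. *)
rewrite gtnNdvd //= -(big_mkord xpredT (fun j => (-1) ^+ j * 'C(w, j)%:R)).
rewrite (big_cat_nat (n := w.+1)) //= addrC big_nat_cond big1 ?add0r; last first.
  by move=> j /andP[/andP[wj _] _]; rewrite bin_small // mulr0.
have := exprDn 1 (-1 : 'Z_q) w; rewrite subrr expr0n eqn0Ngt w0 big_mkord => ->.
by apply: eq_bigr => i _; rewrite expr1n mul1r mulr_natr.
Qed.

End AlternatingSum.

Lemma modn_mul_congr_gauss d L u v : coprime L d -> L * u = L * v %[mod d] -> u = v %[mod d].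
Proof.
move=> Ld; wlog vu : u v / v <= u => [H|].
  have [vu|/ltnW uv] := leqP v u; first exact: H.
  by move=> E; apply/esym; apply: H.
move/eqP; rewrite eqn_mod_dvd ?leq_mul2l ?vu ?orbT // -mulnBr Gauss_dvdr 1?coprime_sym //.
by rewrite -eqn_mod_dvd // => /eqP.
Qed.

Lemma eqn_mod_sum (I : Type) (s : seq I) (P : pred I) (F G : I -> nat) m :
  (forall i, P i -> F i = G i %[mod m]) ->
  \sum_(i <- s | P i) F i = \sum_(i <- s | P i) G i %[mod m].
Proof.
move=> FG; elim/big_ind2: _ => // a b c d ab cd.
by rewrite -modnDm ab cd modnDm.
Qed.

Lemma eqn_mod_divn m q u v : 0 < m -> q %| m ->
  (m %/ q * u == m %/ q * v %[mod m]) = (u == v %[mod q]).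
Proof.
move=> m0 qm; have mq : 0 < m %/ q by rewrite (divn_gt0 _ (dvdn_gt0 m0 qm)) dvdn_leq.
have modE w : m %/ q * w %% m = m %/ q * (w %% q) by rewrite muln_modr divnK.
by rewrite !modE eqn_pmul2l.
Qed.

(** Multiplying by L, the part of m prime to q, kills modulo m every term with p <> q, since p
    divides L; and L is invertible modulo q. *)
Lemma chinese_sum m (u v : nat -> nat) : 0 < m ->
  (\sum_(q <- primes m) m %/ q * u q == \sum_(q <- primes m) m %/ q * v q %[mod m])
  = all (fun q => u q == v q %[mod q]) (primes m).
Proof.
move=> m0; apply/eqP/allP => [E q qm|E]; last first.
  rewrite !big_seq; apply: eqn_mod_sum => q qm.
  by apply/eqP; rewrite eqn_mod_divn ?E //; move: qm; rewrite mem_primes => /and3P[].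
have := qm; rewrite mem_primes => /and3P[qpr _ qdvd].
pose L := m`_q^'.
have Ldvd : L %| m by apply: dvdn_part.
have Lq : coprime L q.
  rewrite coprime_sym -(@coprime_pexpl (logn q m)) ?logn_gt0 // -p_part.
  exact: coprime_partC.
have kill (w : nat -> nat) : L * (\sum_(p <- primes m) m %/ p * w p)
    = m %/ q * (L * w q) %[mod m].
  rewrite (bigD1_seq q) ?primes_uniq //= mulnDr mulnCA -modnDmr.
  suff /eqP-> : m %| L * \sum_(p <- primes m | p != q) m %/ p * w p by rewrite addn0.
  rewrite big_seq_cond big_distrr /=; apply: dvdn_sum => p /andP[pm pq].
  have := pm; rewrite mem_primes => /and3P[ppr _ pdvd].
  have pL : p %| L.
    rewrite -(@Gauss_dvdr _ (m`_q)) ?partnC // p_part.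
    by rewrite coprimeXr // prime_coprime // dvdn_prime2.
  by rewrite -[L](divnK pL) -mulnA [p * _]mulnA [p * _]mulnC divnK // dvdn_mull // dvdn_mulr.
apply/eqP; apply: (modn_mul_congr_gauss Lq); apply/eqP.
by rewrite -(eqn_mod_divn _ _ m0 qdvd) -!kill -modnMmr E modnMmr.
Qed.

Lemma prod_prime_pow_dvd (s : seq nat) (k : nat -> nat) w : uniq s -> all prime s ->
  (forall q, q \in s -> q ^ k q %| w) -> \prod_(q <- s) q ^ k q %| w.
Proof.
elim: s => [|p s IHs]; first by rewrite big_nil dvd1n.
rewrite big_cons /= => /andP[ps us] /andP[ppr spr] sw.
have cop : coprime (p ^ k p) (\prod_(q <- s) q ^ k q).
  rewrite big_seq; elim/big_ind: _ => [|a b|q qs]; first exact: coprimen1.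
    by rewrite coprimeMr => -> ->.
  apply/coprimeXl/coprimeXr; rewrite prime_coprime // dvdn_prime2 //; last exact: (allP spr).
  by apply: contraNneq ps => ->.
rewrite (Gauss_dvd _ cop) (sw p (mem_head p s)) IHs // => q qs.
by apply: sw; rewrite inE qs orbT.
Qed.

(** * Circuits of depth two *)

Lemma cycle_rank (T : Type) (e : rel T) (rk : T -> nat) :
  (forall g h, e g h -> rk h < rk g) -> forall s, 0 < size s -> ~~ path.cycle e s.
Proof.
move=> e_rk [//|g s] _; apply/negP => /=.
have path_rk p h : path e h p -> size p + rk (last h p) <= rk h.
  elim: p h => //= h' p IHp h /andP[/e_rk h'h /IHp le_h']; rewrite addSn.
    exact: leq_ltn_trans le_h' h'h.
by move/path_rk; rewrite last_rcons size_rcons addSn ltnNge leq_addl.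
Qed.

Section TwoLayer.

Variables (m n : nat) (K : finType).
Variables (top : K -> nat) (bot : K -> 'I_n -> nat) (Rs : K -> {set 'Z_m}) (R0 : {set 'Z_m}).
Hypothesis m_gt0 : 0 < m.
Hypothesis n_gt0 : 0 < n.
Hypothesis K_gt0 : 0 < #|K|.

Definition layer_gate := option ('I_n + K).

Definition layer_label (g : layer_gate) : 'I_n + {set 'Z_m} :=
  match g with
  | None => inr R0
  | Some (inl i) => inl i
  | Some (inr k) => inr (Rs k)
  end.

(* Multiplicities only matter mod m; they are moved to the interval [m, 2m)   *)
(* so that no internal gate is left without wires.                            *)
Definition layer_wires (g h : layer_gate) : nat :=
  match g, h with
  | None, Some (inr k) => top k %% m + m
  | Some (inr k), Some (inl i) => bot k i %% m + m
  | _, _ => 0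
  end.

Definition layer_rank (g : layer_gate) : nat :=
  match g with None => 2 | Some (inl _) => 0 | Some (inr _) => 1 end.

Lemma layer_wires_rank g h : 0 < layer_wires g h -> layer_rank h < layer_rank g.
Proof. by case: g h => [[i|k]|] [[i'|k']|]. Qed.

Lemma layer_input_uniq (i : 'I_n) : exists! g, layer_label g = inl i.
Proof. by exists (Some (inl i)); split=> // -[[j|k]|] //= [->]. Qed.

Lemma layer_inputP g :
  (exists i, layer_label g = inl i) <-> (forall h, layer_wires g h = 0).
Proof.
case: g => [[i|k]|]; split=> //=; try by [exists i | case].
- by move=> /(_ (Some (inl (Ordinal n_gt0)))) /eqP; rewrite addn_eq0 (gtn_eqF m_gt0) andbF.
- have /card_gt0P[k _] := K_gt0.
  by move=> /(_ (Some (inr k))) /eqP; rewrite addn_eq0 (gtn_eqF m_gt0) andbF.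
Qed.

Lemma layer_acyclic (s : seq layer_gate) :
  s != [::] -> ~~ path.cycle (fun g h => 0 < layer_wires g h) s.
Proof.
by rewrite -size_eq0 -lt0n; apply: cycle_rank layer_wires_rank s.
Qed.

Definition layer_circuit : circuit m n :=
  Circuit None layer_input_uniq layer_inputP layer_acyclic.

Lemma card_layer_gate : #|{: layer_gate}| = (n + #|K|).+1.
Proof. by rewrite card_option card_sum card_ord. Qed.

Lemma big_layer_gate (F : layer_gate -> nat) :
  \sum_g F g = F None + (\sum_i F (Some (inl i)) + \sum_k F (Some (inr k))).
Proof.
rewrite (bigD1 None) //=; congr addn.
rewrite (reindex_omap Some id) /=; last by case.
rewrite (eq_bigl xpredT) => [|g]; last by rewrite eqxx.
by rewrite big_sumType.
Qed.

Lemma layer_depth : depth layer_circuit = 2.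
Proof.
apply/eqP; rewrite eqn_leq; apply/andP; split.
  apply/bigmax_leqP => k /existsP[p /andP[pp _]].
  have path_rk q h : path (@wire _ _ layer_circuit) h q -> size q <= layer_rank h.
    elim: q h => //= h' q IHq h /andP[/layer_wires_rank h'h /IHq le_h'].
    exact: leq_ltn_trans le_h' h'h.
  by rewrite -(size_tuple p); apply: path_rk pp.
have card2 : 2 < #|gate layer_circuit|.
  by rewrite card_layer_gate ltnS -addn1; apply: leq_add.
have /card_gt0P[k _] := K_gt0.
rewrite /depth; apply: (@leq_bigmax_cond _ _ (@nat_of_ord _) (Ordinal card2)).
apply/existsP; exists [tuple Some (inr k); Some (inl (Ordinal n_gt0))].
by rewrite /wire /= !addn_gt0 m_gt0 !orbT.
Qed.

Lemma layer_size : circuit_size layer_circuit <= (n + #|K|).+1 + (2 * m) * (#|K| * n.+1).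
Proof.
rewrite /circuit_size card_layer_gate leq_add2l big_layer_gate.
have mod_le a : a %% m + m <= 2 * m by rewrite mul2n -addnn leq_add2r ltnW ?ltn_pmod.
rewrite [X in _ + (X + _)]big1 => [|i _]; last by rewrite big_layer_gate !big1.
rewrite add0n big_layer_gate /= add0n big1 // add0n.
rewrite mulnS mulnDr leq_add //.
  by rewrite mulnC -sum_nat_const; apply: leq_sum.
rewrite mulnCA -sum_nat_const; apply: leq_sum => k _; rewrite big_layer_gate /= add0n.
rewrite [X in _ + X]big1 // addn0 mulnC -[X in X * _]card_ord -sum_nat_const.
exact: leq_sum.
Qed.

Lemma layer_val x : gate_val x (output layer_circuit) =
  MOD R0 (\sum_k (top k %% m + m) * MOD (Rs k) (\sum_i (bot k i %% m + m) * x i)).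
Proof.
rewrite gate_valE /=; congr MOD; rewrite big_layer_gate /= mul0n add0n big1 // add0n.
apply: eq_bigr => k _; congr (_ * nat_of_bool _).
rewrite gate_valE /=; congr MOD; rewrite big_layer_gate /= mul0n add0n.
rewrite [X in _ + X]big1 // addn0.
by apply: eq_bigr => i _; congr (_ * nat_of_bool _); rewrite gate_valE.
Qed.

End TwoLayer.

Section LayerFunctions.

Variables (m n : nat).
Local Notation input := {ffun 'I_n -> bool}.

Definition layer_term (t : nat * ('I_n -> nat) * {set 'Z_m}) (x : input) : nat :=
  t.1.1 * MOD t.2 (\sum_i t.1.2 i * x i).

(** The integers that a top gate can receive from at most S weighted bottom gates. *)
Definition layer_fun (S : nat) (f : input -> nat) : Prop :=
  exists2 s, size s <= S & forall x, f x = \sum_(t <- s) layer_term t x.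

Lemma layer_fun_single c (a : 'I_n -> nat) (R : {set 'Z_m}) :
  layer_fun 1 (fun x => c * MOD R (\sum_i a i * x i)).
Proof. by exists [:: (c, a, R)] => // x; rewrite big_seq1. Qed.

Lemma layer_fun_sum (I : Type) (r : seq I) (P : pred I) S (f : I -> input -> nat) :
  (forall i, P i -> layer_fun (S i) (f i)) ->
  layer_fun (\sum_(i <- r | P i) S i) (fun x => \sum_(i <- r | P i) f i x).
Proof.
move=> fP; elim: r => [|i r [s ss sE]]; first by exists [::] => [|x]; rewrite !big_nil.
have [Pi|nPi] := boolP (P i); last first.
  by exists s => [|x]; rewrite big_cons (negPf nPi).
have [t st tE] := fP i Pi; exists (t ++ s) => [|x].
  by rewrite size_cat big_cons Pi leq_add.
by rewrite big_cons Pi big_cat /= tE sE.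
Qed.

Lemma layer_fun_scale c S f : layer_fun S f -> layer_fun S (fun x => c * f x).
Proof.
move=> [s ss sE]; exists [seq (c * t.1.1, t.1.2, t.2) | t <- s] => [|x].
  by rewrite size_map.
by rewrite sE big_map big_distrr; apply: eq_bigr => t _; rewrite /layer_term /= mulnA.
Qed.

Lemma layer_fun_circuit S f (R0 : {set 'Z_m}) : 1 < m -> 0 < n -> layer_fun S f ->
  exists D : circuit m n, [/\ depth D = 2, computes D (fun x => MOD R0 (f x)) &
    circuit_size D <= (n + S).+2 + (2 * m) * (S.+1 * n.+1)].
Proof.
move=> m1 n0 [s sS sE].
(* A dummy term of weight 0 keeps the bottom layer nonempty, so the depth is 2 even when s is
   empty. *)
pose t0 : nat * ('I_n -> nat) * {set 'Z_m} := (0, fun=> 0, set0).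
pose t (k : 'I_(size s).+1) := nth t0 (t0 :: s) k.
have m0 := ltnW m1; have K0 : 0 < #|'I_(size s).+1| by rewrite card_ord.
exists (layer_circuit (fun k => (t k).1.1) (fun k => (t k).1.2) (fun k => (t k).2) R0 m0 n0 K0).
split; first exact: layer_depth.
- move=> x; rewrite layer_val; apply: eq_MOD => //; rewrite sE.
  have -> : \sum_(t <- s) layer_term t x = \sum_k layer_term (t k) x.
    transitivity (\sum_(t <- t0 :: s) layer_term t x); first by rewrite big_cons.
    by rewrite (big_nth t0) big_mkord.
  apply: eqn_mod_sum => k _; rewrite /layer_term.
  have -> : MOD (t k).2 (\sum_i ((t k).1.2 i %% m + m) * x i) =
            MOD (t k).2 (\sum_i (t k).1.2 i * x i).
    apply: eq_MOD => //; apply: eqn_mod_sum => i _.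
    by rewrite -modnMml modnDr modn_mod modnMml.
  by rewrite -modnMml modnDr modn_mod modnMml.
- apply: leq_trans (layer_size _ _ _ _ _ _ _) _; rewrite card_ord.
  by apply: leq_add; [rewrite addnS !ltnS leq_add2l | rewrite !leq_mul].
Qed.

End LayerFunctions.

Lemma sum_small_sets n (Z : {set 'I_n}) Q (F : nat -> nat) :
  \sum_(S : {set 'I_n} | #|S| < Q) F #|S| * (S \subset Z) = \sum_(j < Q) F j * 'C(#|Z|, j).
Proof.
transitivity (\sum_(j < Q) \sum_(S : {set 'I_n}) F j * ((S \subset Z) && (#|S| == j))).
  rewrite exchange_big big_mkcond /=; apply: eq_bigr => S _.
  case: ltnP => SQ; last first.
    by rewrite big1 // => j _; rewrite (gtn_eqF (leq_trans (ltn_ord j) SQ)) andbF muln0.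
  rewrite (bigD1 (Ordinal SQ)) //= eqxx andbT big1 ?addn0 // => j jS.
  by rewrite eq_sym [_ == #|S|](negPf jS) andbF muln0.
apply: eq_bigr => j _; rewrite -big_distrr /= -cards_draws -sum1_card; congr (_ * _).
by rewrite [RHS]big_mkcond; apply: eq_bigr => S _; rewrite inE; case: (_ && _).
Qed.

Lemma leq_bin_expn n j : 'C(n, j) <= n ^ j.
Proof.
elim: n j => [|n IHn] [|j] //; rewrite ?bin0 // binS expnS mulSn addnC.
have mono : n ^ j <= n.+1 ^ j by case: j => // j; rewrite leq_exp2r.
apply: leq_add; first exact: leq_trans (IHn _) mono.
by apply: leq_trans (IHn _) _; rewrite expnS leq_mul.
Qed.

Lemma sum_expn_leq X Q : 0 < X -> \sum_(j < Q) X ^ j <= X.+1 ^ Q.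
Proof.
move=> X0; elim: Q => [|Q IHQ]; first by rewrite big_ord0.
rewrite big_ord_recr /= expnS mulSn leq_add //.
apply: leq_trans (leq_pmull _ X0); case: Q {IHQ} => // Q; by rewrite leq_exp2r.
Qed.

(** * Testing whether a prime power divides the number of zeros *)

Section PrimeGadget.

Variables (m n q p k : nat).
Hypotheses (m0 : 0 < m) (q_prime : prime q) (p_prime : prime p) (p_dvd : p %| m) (pq : p != q).

Local Notation input := {ffun 'I_n -> bool}.
Implicit Types (S : {set 'I_n}) (x : input) (a : {ffun 'I_n -> 'Z_p}).

Let p1 : 1 < p := prime_gt1 p_prime.
Let q1 : 1 < q := prime_gt1 q_prime.
Let Q := q ^ k.

Definition zeros x : {set 'I_n} := [set i | ~~ x i].

Definition dot a x : 'Z_p := (\sum_i a i * (x i)%:R)%R.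

Definition supported S : {pred {ffun 'I_n -> 'Z_p}} := pffun_on 0%R S predT.

Lemma supportedP S a : reflect (forall i, i \notin S -> a i = 0%R) (a \in supported S).
Proof.
apply: (iffP pffun_onP) => [[/subsetP aS _] i|aS]; last split=> //.
  by apply: contraNeq => ai; apply: aS; rewrite unfold_in.
by apply/subsetP => i; rewrite unfold_in; apply: contraR => /aS ->.
Qed.

Lemma card_supported S : #|supported S| = p ^ #|S|.
Proof. by rewrite card_pffun_on card_ord Zp_cast. Qed.

Definition solutions S x (v : 'Z_p) := #|[pred a in supported S | dot a x == v]|.

Lemma solutions_shift S x i (v t : 'Z_p) : i \in S -> x i ->
  solutions S x (v + t)%R = solutions S x v.
Proof.
move=> iS xi; pose d : {ffun 'I_n -> 'Z_p} := [ffun l => if l == i then t else 0%R].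
rewrite /solutions -!sum1_card (reindex_inj (addIr d)) /=; apply: eq_bigl => a.
rewrite !inE; congr (_ && _).
  apply/supportedP/supportedP => aS l lS; have := aS l lS; rewrite !ffunE;
    by rewrite (negPf (contraNneq _ lS)) ?addr0 // => ->.
have -> : dot (a + d)%R x = (dot a x + t)%R.
  rewrite /dot (eq_bigr (fun l => a l * (x l)%:R + d l * (x l)%:R)%R); last first.
    by move=> l _; rewrite !ffunE mulrDl.
  rewrite big_split /=; congr (_ + _)%R.
  rewrite (bigD1 i) //= ffunE eqxx xi mulr1 big1 ?addr0 // => l li.
  by rewrite ffunE (negPf li) mul0r.
by rewrite (inj_eq (addIr t)).
Qed.

(** If x vanishes on S, then [dot a x] is always 0. Otherwise shifting one coordinate of a where x
    is 1 shows that all p values are taken equally often. *)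
Lemma card_solutions S x :
  p * solutions S x 1%R = p ^ #|S| * ~~ (S \subset zeros x).
Proof.
have [/subsetP Sz|/subsetPn[i iS]] := boolP (S \subset zeros x).
  rewrite muln0 /solutions eq_card0 ?muln0 // => a; apply/negbTE/negP => /andP[/supportedP aS].
  rewrite /dot big1 => [|i _]; first by rewrite eq_sym oner_eq0.
  have [iS|iS] := boolP (i \in S); last by rewrite aS ?mul0r.
  by have := Sz i iS; rewrite inE => /negPf->; rewrite mulr0.
rewrite inE negbK => xi; rewrite muln1 -card_supported.
rewrite -[LHS]/(p * _) -{1}(Zp_cast p1) -[X in X * _]card_ord -sum_nat_const.
rewrite -sum1_card (partition_big (fun a => dot a x) xpredT) //=.
apply: eq_bigr => v _; rewrite -[v](subrK 1%R) [(v - 1 + 1)%R]addrC.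
by rewrite -(solutions_shift _ (v - 1)%R iS xi) /solutions -sum1_card; apply: eq_bigl => a.
Qed.

(** The weight m / p turns a congruence modulo m into one modulo p. *)
Lemma MOD_dot a x :
  MOD [set (m %/ p)%:R : 'Z_m]%R (\sum_i (m %/ p * a i) * x i) = (dot a x == 1%R).
Proof.
have m1 : 1 < m by apply: leq_trans p1 (dvdn_leq m0 p_dvd).
rewrite /MOD inE natr_Zp_eq //.
rewrite (eq_bigr (fun i => m %/ p * (a i * x i))) => [|i _]; last by rewrite mulnA.
rewrite -big_distrr /= -[X in _ == X %[mod _]]muln1 eqn_mod_divn //.
rewrite -natr_Zp_eq // natr_sum; congr (_ == _).
by apply: eq_bigr => i _; rewrite natrM natr_Zp.
Qed.

Definition inv_p : nat := ((p%:R : 'Z_q)^-1)%R.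

(* (-1)^|S| p^(1 - |S|) mod q: for S not inside [zeros x], the equation       *)
(* [dot a x = 1] has p^(|S| - 1) solutions supported on S.                    *)
Definition coef S : nat := q.-1 ^ #|S| * (inv_p ^ #|S| * p).

Definition gadget x : nat := \sum_(S : {set 'I_n} | #|S| < Q) coef S *
  \sum_(a in supported S) 1 * MOD [set (m %/ p)%:R : 'Z_m]%R (\sum_i (m %/ p * a i) * x i).

Definition gadget_target : nat := \sum_(S : {set 'I_n} | #|S| < Q) q.-1 ^ #|S|.

Lemma gadget_layer : 0 < n -> layer_fun m ((n * p).+1 ^ Q) gadget.
Proof.
move=> n0; have np0 : 0 < n * p by rewrite muln_gt0 n0 prime_gt0.
have [s ss sE] : layer_fun m (\sum_(S : {set 'I_n} | #|S| < Q) \sum_(a in supported S) 1) gadget.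
  apply: layer_fun_sum => S _; apply: layer_fun_scale; apply: layer_fun_sum => a _.
  exact: layer_fun_single.
exists s => //; apply: leq_trans ss (leq_trans _ (sum_expn_leq Q np0)).
rewrite (eq_bigr (fun S : {set 'I_n} => p ^ #|S| * (S \subset [set: 'I_n]))); last first.
  by move=> S _; rewrite subsetT muln1 sum1_card card_supported.
rewrite (sum_small_sets [set: 'I_n] Q (expn p)) cardsT card_ord; apply: leq_sum => j _.
by rewrite expnMn mulnC leq_mul // leq_bin_expn.
Qed.

(** Modulo q, [gadget] sums (-1)^|S| over the small S not inside [zeros x]. Those inside contribute
    the alternating binomial sum, which is 1 or 0 according to whether Q divides #|zeros x|.
    Together they give [gadget_target]. *)
Lemma gadgetE x :
  (gadget x + 1 == gadget_target %[mod q]) = (Q %| #|zeros x|).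
Proof.
have q0 : (q%:R = 0 :> 'Z_q)%R by apply: pchar_Zp.
have qm1 : (q.-1%:R = -1 :> 'Z_q)%R.
  by apply/eqP; rewrite -subr_eq0 opprK natr1 prednK ?prime_gt0 // q0.
have pU : ((p%:R : 'Z_q) \is a GRing.unit)%R.
  by rewrite unitZpE // prime_coprime // dvdn_prime2 // eq_sym.
have coefE S : ((coef S * solutions S x 1%R)%:R =
    (q.-1 ^ #|S| * ~~ (S \subset zeros x))%:R :> 'Z_q)%R.
  rewrite /coef -!mulnA card_solutions !natrM !natrX /inv_p natr_Zp.
  by rewrite [X in (_ * X)%R]mulrA exprVn mulVr ?mul1r // unitrX.
have innerE S : \sum_(a in supported S) 1 *
    MOD [set (m %/ p)%:R : 'Z_m]%R (\sum_i (m %/ p * a i) * x i) = solutions S x 1%R.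
  rewrite /solutions -sum1_card big_mkcondr /=; apply: eq_bigr => a _.
  by rewrite mul1n MOD_dot; case: eqP.
have := alternating_bin_sum k q_prime #|zeros x|; rewrite -/Q => altE.
rewrite -natr_Zp_eq // natrD.
suff -> : (gadget_target%:R = (gadget x)%:R + (Q %| #|zeros x|)%:R :> 'Z_q)%R.
  by rewrite (inj_eq (addrI _)); case: (Q %| _); rewrite ?eqxx ?oner_eq0.
rewrite -altE (eq_bigr (fun j : 'I_Q => (q.-1 ^ j * 'C(#|zeros x|, j))%:R)%R); last first.
  by move=> j _; rewrite natrM natrX qm1.
rewrite -natr_sum -(sum_small_sets (zeros x) Q (expn q.-1)) /gadget /gadget_target.
rewrite !natr_sum -big_split /=; apply: eq_bigr => S _.
by rewrite innerE coefE -natrD -mulnDr; case: (S \subset zeros x); rewrite muln1.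
Qed.

End PrimeGadget.

Theorem depth2_AND m n y : 1 < size (primes m) -> 0 < n -> n < y.+1 ^ size (primes m) ->
  let S := size (primes m) * (n * m).+1 ^ (m * y) in
  exists D : circuit m n, [/\ depth D = 2, computes D (@AND n) &
    circuit_size D <= (n + S).+2 + (2 * m) * (S.+1 * n.+1)].
Proof.
move=> r2 n0 ny; have m1 : 1 < m by move: r2; case: (m) => [|[]].
have m0 := ltnW m1.
have y0 : 0 < y by move: ny; case: (y) => //; rewrite exp1n ltnS leqNgt n0.
set r := size _ in r2 ny *; move=> S.
(* A second prime of m, available because r >= 2; for q in [primes m] the default 0 does not
   occur. *)
pose other q := head 0 [seq p <- primes m | p != q].
have otherP q : q \in primes m -> (other q \in primes m) && (other q != q).
  move=> qm; suff : other q \in [seq p <- primes m | p != q] by rewrite mem_filter andbC.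
  rewrite /other -nth0 mem_nth // size_filter -(ltn_add2l (count (pred1 q) (primes m))).
  by rewrite addn0 (count_predC (pred1 q)) count_uniq_mem ?primes_uniq // qm.
(* The least power of q above y: at most q * y <= m * y, while the product over q is at least y.+1 ^
   r > n. *)
pose k q := (trunc_log q y).+1.
have prime_m q : q \in primes m -> prime q /\ q %| m.
  by rewrite mem_primes => /and3P[].
pose g q (x : {ffun 'I_n -> bool}) := gadget m q (other q) (k q) x.
pose target := \sum_(q <- primes m) m %/ q * gadget_target n q (k q).
pose shift := \sum_(q <- primes m) m %/ q * 1.
have gS : layer_fun m S (fun x : {ffun 'I_n -> bool} =>
    \sum_(q <- primes m | q \in primes m) m %/ q * g q x).
  have [s ss sE] : layer_fun m (\sum_(q <- primes m | q \in primes m) (n * other q).+1 ^ (q ^ k q))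
      (fun x : {ffun 'I_n -> bool} => \sum_(q <- primes m | q \in primes m) m %/ q * g q x).
    apply: layer_fun_sum => q qm; apply: layer_fun_scale.
    have [/prime_m[? ?] _] := andP (otherP q qm).
    by apply: gadget_layer.
  exists s => //; apply: leq_trans ss _; rewrite -big_seq.
  apply: leq_trans (_ : \sum_(q <- primes m) (n * m).+1 ^ (m * y) <= _); last first.
    by rewrite big_const_seq count_predT iter_addn_0 mulnC.
  rewrite !big_seq; apply: leq_sum => q qm.
  have [/prime_m[opr odvd] _] := andP (otherP q qm).
  have [qpr qdvd] := prime_m q qm.
  have Qy : q ^ k q <= m * y.
    rewrite /k expnS; apply: leq_mul; first exact: dvdn_leq.
    by apply: trunc_logP => //; apply: prime_gt1.
  apply: leq_trans (_ : (n * m).+1 ^ (q ^ k q) <= _); last by rewrite leq_pexp2l.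
  rewrite leq_exp2r; last by rewrite expn_gt0 prime_gt0.
  by rewrite ltnS leq_mul2l (dvdn_leq m0 odvd) orbT.
have [D [Dd DC DS]] := layer_fun_circuit [set z : 'Z_m | z + shift%:R == target%:R]%R m1 n0 gS.
exists D; split=> // x; rewrite DC /MOD inE -big_seq -natrD natr_Zp_eq // -big_split /=.
rewrite (eq_bigr (fun q => m %/ q * (g q x + 1))); last by move=> q _; rewrite mulnDr.
rewrite (chinese_sum (fun q => g q x + 1) _ m0).
have w_lt : #|zeros x| < \prod_(q <- primes m) q ^ k q.
  apply: leq_ltn_trans (max_card _) _; rewrite card_ord; apply: leq_trans ny _.
  rewrite -[r]count_predT -iter_muln_1 -big_const_seq big_seq [leqRHS]big_seq.
  by apply: leq_prod => q /prime_m[qpr _]; apply: trunc_log_ltn; apply: prime_gt1.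
apply/allP/forallP => [all_q i|xT q qm]; last first.
  have [/prime_m[opr odvd] oq] := andP (otherP q qm); have [qpr _] := prime_m q qm.
  rewrite gadgetE // (_ : zeros x = set0) ?cards0 //.
  by apply/setP => i; rewrite !inE xT.
apply: contraT => xi.
have w0 : 0 < #|zeros x| by apply/card_gt0P; exists i; rewrite inE.
move: w_lt; rewrite ltnNge => /negP[]; apply: dvdn_leq => //.
apply: prod_prime_pow_dvd; first exact: primes_uniq.
  by apply/allP => q /prime_m[].
move=> q qm; have [/prime_m[opr odvd] oq] := andP (otherP q qm); have [qpr _] := prime_m q qm.
by have := all_q q qm; rewrite gadgetE.
Qed.

(** * Asymptotics *)

(** Each of the k factors of N ^_ k is at least k * z, and k! <= k ^ k. *)
Lemma leq_bin_lower N k z : k * z + k <= N.+1 -> z ^ k <= 'C(N, k).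
Proof.
move=> zN; have [->|k0] := posnP k; first by rewrite bin0.
rewrite -(@leq_pmul2r (k ^ k)) ?expn_gt0 ?k0 // -expnMn [z * k]mulnC.
have ffact_lo i : i <= k -> (k * z) ^ i <= N ^_ i.
  elim: i => // i IHi ik; rewrite expnSr ffactnSr leq_mul ?IHi ?(ltnW ik) //.
  by move: zN ik; clear; lia.
have fact_hi i : i <= k -> i`! <= k ^ i.
  by elim: i => // i IHi ik; rewrite factS expnS leq_mul ?IHi ?(ltnW ik).
apply: leq_trans (ffact_lo _ (leqnn k)) _.
by rewrite -bin_ffact leq_mul2l fact_hi ?orbT.
Qed.

Section BlockSize.

Variables (m y : nat).
Hypotheses (m0 : 0 < m) (y0 : 0 < y).

Definition block : nat := \prod_(q <- primes m) q ^ trunc_log q y.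

Lemma prod_primes (k : nat -> nat) w : (forall q, q \in primes m -> q ^ k q %| w) ->
  \prod_(q <- primes m) q ^ k q %| w.
Proof.
apply: prod_prime_pow_dvd; first exact: primes_uniq.
by apply/allP => q; rewrite mem_primes => /andP[].
Qed.

Lemma expn_size_primes a : a ^ size (primes m) = \prod_(q <- primes m) a.
Proof. by rewrite big_const_seq count_predT iter_muln_1. Qed.

Lemma block_le : block <= y ^ size (primes m).
Proof.
rewrite expn_size_primes /block !big_seq; apply: leq_prod => q.
by rewrite mem_primes => /andP[/prime_gt1 q1 _]; apply: trunc_logP.
Qed.

Lemma block_ge : y.+1 ^ size (primes m) <= block * m.
Proof.
have rad : \prod_(q <- primes m) q <= m.
  apply: dvdn_leq => //; have := @prod_primes (fun=> 1) m.
  under eq_bigr do rewrite expn1; apply=> q; rewrite mem_primes expn1.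
  by case/and3P.
apply: leq_trans (leq_mul (leqnn _) rad); rewrite -big_split /= expn_size_primes.
rewrite big_seq [leqRHS]big_seq; apply: leq_prod => q.
by rewrite mem_primes => /andP[/prime_gt1 q1 _]; rewrite -expnSr; apply: trunc_log_ltn.
Qed.

(** The q-parts of t and m multiply to at most t * m <= y, so their exponents add up to at most
    [trunc_log q y]. *)
Lemma dvdn_bin_block t : 0 < t <= block -> t * m <= y -> m %| 'C(block, t).
Proof.
move=> t_block tm; have /andP[t0 tM] := t_block.
rewrite [X in X %| _](prod_prime_decomp m0) prime_decompE big_map /=.
apply: prod_primes => q qm; have := qm; rewrite mem_primes => /andP[qpr _].
have M0 : 0 < block by apply: leq_trans tM.
apply: dvdn_bin_pfactor => //; apply: leq_trans (_ : trunc_log q y <= _); last first.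
  by rewrite -pfactor_dvdn // /block (big_rem q) //= dvdn_mulr.
apply: trunc_log_max (prime_gt1 qpr) _; rewrite expnD; apply: leq_trans tm.
by apply: leq_mul; apply: dvdn_leq => //; apply: pfactor_dvdnn.
Qed.

End BlockSize.

(** With j = y / m and z about y / 12, 'C(M / 3, j+1) >= z^(j+1). As y <= z^2 and y < (j+1) m, y^y
    <= z^(2 (j+1) m) <= #|gate C|^(4 m). *)
Theorem symmetric_AND_size m n y (C : circuit m n) : 1 < size (primes m) ->
    symmetric_circuit [set: 'S_n]%G C -> computes C (@AND n) ->
    2 * y ^ size (primes m) <= n -> m <= y -> 200 <= y ->
  y ^ y <= #|gate C| ^ (4 * m).
Proof.
move=> r2 symC andC; set r := size _ in r2 * => yn my y200.
have m1 : 1 < m by move: r2; rewrite /r; case: (m) => [|[]].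
have m0 := ltnW m1; have y0 : 0 < y by apply: leq_trans y200.
pose M := block m y; pose j := y %/ m.
have jm : j * m <= y by apply: leq_trunc_div.
have jm' : y < j.+1 * m by apply: ltn_ceil.
have yr : y <= y ^ r by rewrite -{1}[y]expn1 leq_pexp2l // ltnW.
have yM : y.+1 * y.+1 <= M * m.
  by apply: leq_trans (block_ge y m0); rewrite mulnn leq_pexp2l.
have Mr : M <= y ^ r by apply: block_le.
have j9 : 9 * j <= M.
  by rewrite -(leq_pmul2r m0); move: jm yM y200; clear; nia.
have M6 : 5 < M by rewrite -(ltn_pmul2r m0); move: my yM y200; clear; nia.
have jn : j <= y by apply: leq_div.
(* The 12 gives 6 (z+1) <= y, hence 3 (j+1) (z+1) m <= y^2 <= M m; and 200 <= y still ensures y <=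
   z^2. *)
pose z := y %/ 12.
have zz : y <= z ^ 2 by rewrite -mulnn /z; move: y200; clear; nia.
have zM : j.+1 * z + j.+1 <= (M %/ 3).+1.
  suff : 3 * (j.+1 * z.+1) <= M by clear; lia.
  rewrite -(leq_pmul2r m0); apply: leq_trans yM.
  have jm2 : j.+1 * m <= 2 * y by move: jm my; clear; lia.
  have z6 : 6 * z.+1 <= y by rewrite /z; move: y200; clear; lia.
  by move: jm2 z6; clear; nia.
have lower : 'C(M %/ 3, j.+1) <= #|gate C| ^ 2.
  apply: (symmetric_AND_lower symC m1 andC) => //.
  - by move: Mr jn yr yn; clear; lia.
  - by move: j9; clear; lia.
  move=> t /andP[t0 tj]; apply: dvdn_bin_block => //.
    by rewrite t0; move: tj j9; clear; lia.
  by apply: leq_trans jm; rewrite leq_mul2r tj orbT.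
have zs : z ^ j.+1 <= #|gate C| ^ 2 := leq_trans (leq_bin_lower zM) lower.
apply: leq_trans (_ : y ^ (j.+1 * m) <= _); first by rewrite leq_pexp2l // ltnW.
have -> : 4 * m = 2 * (2 * m) by rewrite mulnA.
rewrite [X in _ <= X]expnM; apply: leq_trans (_ : (z ^ j.+1) ^ (2 * m) <= _); last first.
  by rewrite leq_exp2r // muln_gt0.
rewrite -expnM (_ : j.+1 * (2 * m) = 2 * (j.+1 * m)); last by rewrite mulnCA.
by rewrite [X in _ <= X]expnM leq_exp2r // muln_gt0.
Qed.

Lemma nroot_exists r n : 0 < r -> exists y, y ^ r <= n < y.+1 ^ r.
Proof.
move=> r0; have ex0 : exists y, y ^ r <= n by exists 0; rewrite exp0n.
have bnd y : y ^ r <= n -> y <= n.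
  apply: leq_trans; case: y => // y.
  by rewrite -{1}[y.+1]expn1 leq_pexp2l.
case: (ex_maxnP ex0 bnd) => y yn ymax; exists y; rewrite yn /= ltnNge.
by apply/negP => /ymax; rewrite ltnn.
Qed.

Lemma depth2_size_expn m n y r S : 0 < m -> 0 < y -> 8 * m + r + 4 <= n ->
    S <= r * (n * m).+1 ^ (m * y) ->
  (n + S).+2 + (2 * m) * (S.+1 * n.+1) <= n ^ ((4 + 2 * m) * y).
Proof.
move=> m0 y0 nm S_le.
have n1 : 0 < n by move: nm m0; clear; lia.
have Sle : S <= n ^ (1 + 2 * (m * y)).
  apply: leq_trans S_le _; rewrite expnD expn1 leq_mul //; first by move: nm; clear; lia.
  rewrite [X in _ <= X]expnM leq_exp2r ?muln_gt0 ?m0 //; move: nm n1; clear; nia.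
apply: leq_trans (_ : n ^ (1 + 2 * (m * y)) * n ^ 3 <= _); last first.
  rewrite -expnD leq_pexp2l //; move: y0; clear; nia.
apply: leq_trans (_ : (n + n ^ (1 + 2 * (m * y))).+2
    + (2 * m) * ((n ^ (1 + 2 * (m * y))).+1 * n.+1) <= _).
  by apply: leq_add; [rewrite !ltnS leq_add2l | rewrite !leq_mul].
have : 0 < n ^ (1 + 2 * (m * y)) by rewrite expn_gt0 n1.
move: (n ^ _) => X X0.
have le1 : (n + X).+2 <= 4 * n * X by move: nm m0 X0; clear; nia.
have le2 : X.+1 * n.+1 <= 4 * n * X by move: n1 X0; clear; nia.
apply: leq_trans (leq_add le1 (leq_mul (leqnn _) le2)) _.
have -> : 4 * n * X + 2 * m * (4 * n * X) = X * n * (4 + 8 * m) by clear; lia.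
have -> : X * n ^ 3 = X * n * (n * n) by rewrite !expnS expn0; clear; lia.
by rewrite leq_mul2l; apply/orP; right; move: nm n1; clear; nia.
Qed.

(** * Passage to real exponents *)

Section RealBounds.

Local Open Scope ring_scope.

Variable R : realType.

Lemma powR_natXV (a r : nat) : (0 < r)%N -> ((a ^ r)%N%:R : R) `^ r%:R^-1 = a%:R.
Proof.
move=> r0; rewrite natrX -powR_mulrn ?ler0n // -powRrM mulfV ?powRr1 ?ler0n //.
by rewrite pnatr_eq0 -lt0n.
Qed.

Lemma ler_powRV (a b r : nat) : (a <= b)%N -> (a%:R : R) `^ r%:R^-1 <= b%:R `^ r%:R^-1.
Proof.
by move=> ab; apply: ge0_ler_powR; rewrite ?nnegrE ?ler_nat ?invr_ge0 ?ler0n.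
Qed.

Lemma ler_ln_nat (a b : nat) : (0 < a)%N -> (a <= b)%N -> ln a%:R <= ln b%:R :> R.
Proof. by move=> a0 ab; rewrite ler_ln ?ler_nat // posrE ltr0n // (leq_trans a0). Qed.

Lemma lnX_nat (a k : nat) : (0 < a)%N -> ln (a ^ k)%N%:R = k%:R * ln a%:R :> R.
Proof. by move=> a0; rewrite natrX lnXn ?ltr0n // mulr_natl. Qed.

Lemma ln2_le : ln 2 <= 2 :> R. Proof. by apply/ltW/ln_sublinear. Qed.

Lemma ln2_gt0 : 0 < ln 2 :> R. Proof. by apply: ln_gt0; rewrite ltr1n. Qed.

(** With n^(1/r) <= 4 y, ln n <= 2 r ln y, ln 2 <= 2 and y ln y <= 4 m ln s, the constant is 4 * 2 *
    2 * 4 = 64 times m r. *)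
Lemma powR_lower (m r n y s : nat) : (0 < m)%N -> (0 < r)%N -> (4 <= y)%N -> (0 < s)%N ->
    (0 < n)%N -> (n <= 2 * y.+1 ^ r)%N -> (y ^ y <= s ^ (4 * m))%N ->
  2 `^ ((64 * m * r)%N%:R^-1 * (n%:R `^ r%:R^-1 * ln n%:R)) <= s%:R :> R.
Proof.
move=> m0 r0 y4 s0 n0 ny ys; have y0 : (0 < y)%N by apply: leq_trans y4.
have two_r : (2 <= 2 ^ r)%N by rewrite -{1}[2%N]expn1 leq_exp2l.
have n4y : (n <= (4 * y) ^ r)%N.
  apply: leq_trans ny _; apply: leq_trans (_ : 2 ^ r * y.+1 ^ r <= _)%N; first by rewrite leq_mul.
  by rewrite -expnMn leq_exp2r //; move: y0; clear; lia.
have ny2 : (n <= y ^ (2 * r))%N.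
  apply: leq_trans n4y _; rewrite expnM leq_exp2r // -mulnn leq_mul //.
have nroot : n%:R `^ r%:R^-1 <= (4 * y)%N%:R :> R.
  by rewrite -(powR_natXV (4 * y) r0); apply: ler_powRV.
have lnn : ln n%:R <= (2 * r)%N%:R * ln y%:R :> R.
  by rewrite -lnX_nat //; apply: ler_ln_nat.
have lnys : y%:R * ln y%:R <= (4 * m)%N%:R * ln s%:R :> R.
  by rewrite -!lnX_nat //; apply: ler_ln_nat; rewrite // expn_gt0 y0.
have lnn0 : 0 <= ln n%:R :> R by apply: ln_ge0; rewrite ler1n.
have root0 : 0 <= n%:R `^ r%:R^-1 :> R by apply: powR_ge0.
rewrite -ler_ln ?posrE ?powR_gt0 ?ltr0n // ln_powR.
have c0 : 0 < (64 * m * r)%N%:R :> R by rewrite ltr0n !muln_gt0 m0 r0.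
rewrite -mulrA mulrC ler_pdivrMr //.
apply: le_trans (_ : (4 * y)%N%:R * ((2 * r)%N%:R * ln y%:R) * 2 <= _).
  apply: ler_pM (ltW ln2_gt0) _ ln2_le; first exact: mulr_ge0.
  exact: ler_pM.
rewrite !natrM in lnys *.
have -> : 4 * y%:R * (2 * r%:R * ln y%:R) * 2 = 16 * r%:R * (y%:R * ln y%:R) :> R by lra.
have -> : ln s%:R * (64 * m%:R * r%:R) = 16 * r%:R * (4 * m%:R * ln s%:R) :> R by lra.
by apply: ler_wpM2l lnys; rewrite mulr_ge0 ?ler0n.
Qed.

Lemma powR_upper (K r n y s : nat) : (0 < r)%N -> (0 < n)%N -> (0 < s)%N -> (y ^ r <= n)%N ->
    (s <= n ^ (K * y))%N ->
  s%:R <= 2 `^ ((K%:R / ln 2) * (n%:R `^ r%:R^-1 * ln n%:R)) :> R.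
Proof.
move=> r0 n0 s0 yn sn.
have yroot : y%:R <= n%:R `^ r%:R^-1 :> R.
  by rewrite -(powR_natXV y r0); apply: ler_powRV.
have lnn0 : 0 <= ln n%:R :> R by apply: ln_ge0; rewrite ler1n.
have ln2 := ln2_gt0; have ln2' : ln 2 != 0 :> R by rewrite gt_eqF.
rewrite -ler_ln ?posrE ?powR_gt0 ?ltr0n // ln_powR.
apply: le_trans (ler_ln_nat s0 sn) _; rewrite lnX_nat // natrM.
rewrite [leRHS]mulrAC divfK // -mulrA ler_wpM2l ?ler0n //.
exact: ler_wpM2r.
Qed.

End RealBounds.

Local Open Scope ring_scope.

Theorem theorem1p1 (R : realType) (m r : nat)
    (hm : (6 <= m)%N) (hr : r = size (primes m)) (hr2 : (2 <= r)%N) :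
  (forall C : (forall n : nat, (0 < n)%N -> circuit m n),
     (forall (n : nat) (hn : (0 < n)%N),
        symmetric_circuit [set: 'S_n]%G (C n hn) /\
        computes (C n hn) (@AND n)) ->
     exists2 c : R, 0 < c &
       exists n0 : nat, forall (n : nat) (hn : (0 < n)%N), (n0 <= n)%N ->
         2 `^ (c * (n%:R `^ (r%:R)^-1 * ln n%:R))
           <= (circuit_size (C n hn))%:R) /\
  (exists D : (forall n : nat, (0 < n)%N -> circuit m n),
     (forall (n : nat) (hn : (0 < n)%N),
        depth (D n hn) = 2%N /\ computes (D n hn) (@AND n)) /\
     exists2 c : R, 0 < c &
       exists n0 : nat, forall (n : nat) (hn : (0 < n)%N), (n0 <= n)%N ->
         (circuit_size (D n hn))%:R
           <= 2 `^ (c * (n%:R `^ (r%:R)^-1 * ln n%:R))).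
Proof.
have m0 : (0 < m)%N by apply: leq_trans hm.
have r0 : (0 < r)%N := ltnW hr2.
have r2 : (1 < size (primes m))%N by rewrite -hr.
split=> [C hC|].
  exists (64 * m * r)%N%:R^-1; first by rewrite invr_gt0 ltr0n !muln_gt0 m0 r0.
  (* Beyond this threshold the integer r-th root y of n / 2 is at least m + 200. *)
  exists (2 * (m + 200) ^ r)%N => n hn n_large.
  have [symC andC] := hC n hn.
  have [y /andP[yn ny]] := nroot_exists (n %/ 2) r0.
  have y_large : (m + 200 <= y)%N.
    rewrite -ltnS -(@ltn_exp2r _ _ r) //; apply: leq_ltn_trans ny.
    by rewrite leq_divRL // mulnC.
  have yn2 : (2 * y ^ r <= n)%N by move: yn; rewrite leq_divRL // mulnC.
  have ny2 : (n <= 2 * y.+1 ^ r)%N by move: ny; rewrite ltn_divLR // mulnC => /ltnW.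
  have gate_gt0 : (0 < #|gate (C n hn)|)%N by apply/card_gt0P; exists (output (C n hn)).
  apply: le_trans (_ : #|gate (C n hn)|%:R <= _); last by rewrite ler_nat leq_addr.
  apply: (powR_lower R (y := y)) => //; first by apply: leq_trans y_large; rewrite addnC.
  apply: symmetric_AND_size symC andC _ _ _ => //; first by rewrite -hr.
    exact: leq_trans (leq_addr _ _) y_large.
  exact: leq_trans (leq_addl _ _) y_large.
have exD n (hn : (0 < n)%N) : exists D : circuit m n,
    [/\ depth D = 2, computes D (@AND n) & exists y, [/\ (0 < y)%N, (y ^ r <= n)%N &
      let S := (r * (n * m).+1 ^ (m * y))%N in
      (circuit_size D <= (n + S).+2 + (2 * m) * (S.+1 * n.+1))%N]].
  have [y /andP[yn ny]] := nroot_exists n r0.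
  have y0 : (0 < y)%N by case: y ny {yn} => //; rewrite exp1n ltnS leqNgt hn.
  rewrite hr in ny; have [D [Dd DC DS]] := depth2_AND r2 hn ny.
  by exists D; split=> //; exists y; rewrite hr in yn *.
exists (fun n hn => sval (cid (exD n hn))); split.
  by move=> n hn; case: (cid _) => D [].
exists ((4 + 2 * m)%N%:R / ln 2); first by rewrite divr_gt0 ?ln2_gt0 // ltr0n.
exists (8 * m + r + 4)%N => n hn n_large.
case: (cid _) => D /= [_ _ [y [y0 yn DS]]].
apply: (@powR_upper R _ r n y) => //.
  by rewrite addn_gt0; apply/orP; left; apply/card_gt0P; exists (output D).
exact: leq_trans DS (depth2_size_expn m0 y0 n_large (leqnn _)).
Qed.
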